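(* Let $(\iota_1,\iota_2)$ be a commensuration between profinite groups $G_1$ and $G_2$ over a profinite group $H$, and let $G:=G_1\amalg_H G_2$ be the free profinite amalgamated product. Then $(\iota_1,\iota_2)$ admits a completion (in the category of profinite groups) if and only if $H$ is a virtual retract of $G$, meaning that the natural map $H\to G$ is injective and its image is a virtual retract of $G$.
   Context: A commensuration between profinite groups $G_1,G_2$ over a profinite group $H$ is a pair $(\iota_1,\iota_2)$ of continuous monomorphisms $\iota_i:H\to G_i$ with open images, $i=1,2$. A completion of $(\iota_1,\iota_2)$ is a pair $(j_1,j_2)$ of continuous monomorphisms $j_i:G_i\to K$ with open images into a common profinite group $K$ such that $j_1\circ\iota_1=j_2\circ\iota_2$. The free profinite amalgamated product $G_1\amalg_H G_2$ is the pushout of $\iota_1,\iota_2$ in the category of profinite groups and continuous homomorphisms; the natural map $H\to G$ is the composite of $\iota_1$ (equivalently $\iota_2$) with the natural map $G_1\to G$ (resp. $G_2\to G$), and it need not be injective in general. A closed subgroup $N$ of a profinite group $G$ is a virtual retract of $G$ if there are an open subgroup $K$ of $G$ containing $N$ and a continuous epimorphism $\rho:K\to N$ restricting to the identity on $N$. *)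

(* Defs.v *)
From HB Require Import structures.
From mathcomp Require Import all_boot all_classical topology.

Set Implicit Arguments.
Unset Strict Implicit.
Unset Printing Implicit Defensive.

Import Algebra.

Local Open Scope classical_set_scope.
Local Open Scope group_scope.

HB.mixin Record isTopologicalGroup G & Topological G & Group G := {
  mulg_continuous : continuous (fun x : G * G => x.1 * x.2);
  invg_continuous : continuous (fun x : G => x^-1)
}.

#[short(type="topologicalGroupType")]
HB.structure Definition TopologicalGroup :=
  {G of Topological G & Group G & isTopologicalGroup G}.

HB.mixin Record isProfinite G & Topological G := {
  profinite_compact : compact [set: G];
  profinite_hausdorff : hausdorff_space G;
  profinite_totally_disconnected : totally_disconnected [set: G]
}.

#[short(type="profiniteGroupType")]
HB.structure Definition ProfiniteGroup :=
  {G of TopologicalGroup G & isProfinite G}.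

Definition continuous_hom (G K : profiniteGroupType) (f : G -> K) : Prop :=
  monoid_morphism f /\ continuous f.

Definition open_mono (G K : profiniteGroupType) (f : G -> K) : Prop :=
  [/\ continuous_hom f, injective f & open (range f)].

Definition commensuration (H G1 G2 : profiniteGroupType)
    (iota1 : H -> G1) (iota2 : H -> G2) : Prop :=
  open_mono iota1 /\ open_mono iota2.

Definition completion (H G1 G2 K : profiniteGroupType)
    (iota1 : H -> G1) (iota2 : H -> G2) (j1 : G1 -> K) (j2 : G2 -> K) : Prop :=
  [/\ open_mono j1, open_mono j2 & j1 \o iota1 = j2 \o iota2].

Definition admits_completion (H G1 G2 : profiniteGroupType)
    (iota1 : H -> G1) (iota2 : H -> G2) : Prop :=
  exists (K : profiniteGroupType) (j1 : G1 -> K) (j2 : G2 -> K),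
    completion iota1 iota2 j1 j2.

(* The free profinite amalgamated product is determined, up to unique
   isomorphism, by the universal property of the pushout: (G, g1, g2) is
   G1 \amalg_H G2 together with its natural maps.  The maps g1 and g2 are not
   required to be injective. *)
Definition free_profinite_amalgam (H G1 G2 G : profiniteGroupType)
    (iota1 : H -> G1) (iota2 : H -> G2) (g1 : G1 -> G) (g2 : G2 -> G) : Prop :=
  [/\ continuous_hom g1, continuous_hom g2, g1 \o iota1 = g2 \o iota2 &
    forall (K : profiniteGroupType) (f1 : G1 -> K) (f2 : G2 -> K),
      continuous_hom f1 -> continuous_hom f2 -> f1 \o iota1 = f2 \o iota2 ->
      exists! f : G -> K, [/\ continuous_hom f, f \o g1 = f1 & f \o g2 = f2]].

(* The epimorphism rho : K -> N is encoded by a total function on G of which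
   only the values on K matter. *)
Definition virtual_retract (G : profiniteGroupType) (N : set G) : Prop :=
  [/\ group_closed [in N], closed N &
    exists (K : set G) (rho : G -> G),
      [/\ group_closed [in K], open K & N `<=` K] /\
      [/\ {in K &, {morph rho : x y / x * y}},
          {within K, continuous rho},
          rho @` K = N &
          {in N, rho =1 id}]].

(* Main.v *)
(* If [j1], [j2] is a completion into [K], let [f : G -> K] be the induced map,
   [phi = j1 \o iota1] and [eta = g1 \o iota1]; then [eta \o phi^-1 \o f] retracts
   the open subgroup [f^-1 (phi H)] onto [eta H].

   Conversely let [rho : U -> H] come from the retraction and let [A] be the
   abstract group generated by the images of [G1] and [G2].  An element of
   [U] killed by [rho] commensurates [H], hence centralises an open subgroup of
   [H]; as [A] is generated by [H] and finitely many elements, some open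
   subgroup [N] of [H] is normalised by [A] and acted on by [A] through a finite
   group of outer automorphisms.  Then [N] is normal in [G1] and [G2], the finite
   amalgam of the [Gi / N] embeds in a finite permutation group [P], and [G] may
   be replaced by [G * P], where [G1] and [G2] embed.

   In [G * P], [rho] restricts to a homomorphism [p : C0 -> Z(N)] on a subgroup
   [C0] of the centraliser of [N] such that [C0 N] has finite index and is normal
   in [A].  The product [tau] of the finitely many conjugates [p_g] of [p] is
   equivariant and raises elements of the centre to a power [m], so that
   [ker tau] is an invariant complement of [Z(N)] up to [m]-torsion and finite
   index.  The differences [p_g / p] generate a finitely generated abelian group
   [E]; restricting to the [c] whose [p_g c] all lie in a torsion-free power
   [E^k] kills the torsion, and yields a normal subgroup [F] of [A] meeting [H]
   trivially with [F H] of finite index.  The completion is [A / F], topologised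
   so that [H] is open: neither closures nor quotient topologies are needed. *)
Require Import Defs.
From HB Require Import structures.
From mathcomp Require Import all_boot finmap perm all_classical topology.

Set Implicit Arguments.
Unset Strict Implicit.
Unset Printing Implicit Defensive.

Import Algebra.

Local Open Scope classical_set_scope.
Local Open Scope group_scope.

(** * Subgroups, indices and cosets *)

Section AbstractGroups.
Context {G : groupType}.
Implicit Types (A B M : set G) (s : seq G).

Definition subgroup A :=
  [/\ A 1, forall x y, A x -> A y -> A (x * y) & forall x, A x -> A x^-1].

Lemma subgroupI A B : subgroup A -> subgroup B -> subgroup (A `&` B).
Proof.
move=> [A1 AM AV] [B1 BM BV].
split=> [//|x y [? ?] [? ?]|x [? ?]]; split;
by [exact: AM|exact: BM|exact: AV|exact: BV].
Qed.

(** The index is bounded by a finite colouring whose colour classes in [A] each lie in one left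
    coset of the subgroup [B]. Colourings combine by products, and [B] need not be contained in
    [A]. *)
Definition finite_index A B := exists (T : finType) (k : G -> T),
  forall x y, A x -> A y -> k x = k y -> B (x^-1 * y).

Lemma finite_index_sub A A' B B' :
  A' `<=` A -> B `<=` B' -> finite_index A B -> finite_index A' B'.
Proof.
move=> AA BB [T [k kP]]; exists T, k => x y /AA Ax /AA Ay /(kP _ _ Ax Ay).
exact: BB.
Qed.

Lemma finite_indexI A B B' :
  finite_index A B -> finite_index A B' -> finite_index A (B `&` B').
Proof.
move=> [T [k kP]] [T' [k' kP']]; exists (T * T')%type, (fun x => (k x, k' x)).
by move=> x y Ax Ay [/(kP _ _ Ax Ay) ? /(kP' _ _ Ax Ay)].
Qed.

Lemma finite_index_cover A B s : subgroup B ->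
  (forall x, A x -> exists2 y, y \in s & B (y^-1 * x)) -> finite_index A B.
Proof.
move=> [B1 BM BV] sP.
pose k x : 'I_(size s).+1 := inord (find (fun y => `[< B (y^-1 * x) >]) s).
have kP x : A x -> B ((nth 1 s (k x))^-1 * x).
  move=> /sP[y ys By]; have hs : has (fun y => `[< B (y^-1 * x) >]) s.
    by apply/hasP; exists y => //; exact/asboolP.
  rewrite /k inordK ?ltnS ?find_size//.
  by apply/asboolP; exact: (nth_find 1 hs).
exists 'I_(size s).+1, k => x y /kP Bx /kP By kxy.
move: Bx By; rewrite kxy => /BV Bx By.
by have := BM _ _ Bx By; rewrite ?gnorm.
Qed.

Lemma finite_index_reps A B : finite_index A B ->
  exists2 s : seq G, (forall y, y \in s -> A y) &
             (forall x, A x -> exists2 y, y \in s & B (y^-1 * x)).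
Proof.
move=> [T [k kP]].
have [r rP] : {r : T -> G | forall x, A x -> A (r (k x)) /\ k (r (k x)) = k x}.
  exists (fun t => xget 1 [set x | A x /\ k x = t]) => x Ax.
  by case: xgetP => [y _ []//|/(_ x)/not_andP[]].
exists [seq y <- [seq r t | t <- enum T] | `[< A y >]].
  by move=> y; rewrite mem_filter => /andP[/asboolP].
move=> x Ax; have [Ar kr] := rP x Ax; exists (r (k x)); last exact: kP.
by rewrite mem_filter map_f ?mem_enum// andbT; exact/asboolP.
Qed.

Definition coset_rep B x := xget 1 [set y | B (x^-1 * y)].

Lemma coset_repP B x : subgroup B -> B (x^-1 * coset_rep B x).
Proof.
move=> [B1 _ _]; rewrite /coset_rep; case: xgetP => [y _ //|/(_ x)].
by rewrite /= mulVg.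
Qed.

(** The two cosets coincide as sets, so [xget] makes the same choice in both. *)
Lemma eq_coset_rep B x y :
  subgroup B -> B (x^-1 * y) -> coset_rep B x = coset_rep B y.
Proof.
move=> [B1 BM BV] Bxy; rewrite /coset_rep; congr xget.
apply/seteqP; split=> z /= Bz.
- by have := BM _ _ (BV _ Bxy) Bz; rewrite ?gnorm.
- by have := BM _ _ Bxy Bz; rewrite ?gnorm.
Qed.

Lemma coset_repK B x : subgroup B -> coset_rep B (coset_rep B x) = coset_rep B x.
Proof. by move=> sB; apply/esym/eq_coset_rep => //; exact: coset_repP. Qed.

Lemma coset_rep_in A B x :
  subgroup A -> subgroup B -> B `<=` A -> A x -> A (coset_rep B x).
Proof.
move=> [_ AM _] sB BA Ax; rewrite -[coset_rep B x](mulVKg x).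
by apply: (AM) => //; apply: BA; exact: coset_repP.
Qed.

Lemma transversal A B : subgroup A -> subgroup B -> B `<=` A ->
  finite_index A B ->
  exists s : seq G, [/\ uniq s, forall x, A x -> coset_rep B x \in s &
    forall y, y \in s -> A y /\ coset_rep B y = y].
Proof.
move=> sA sB BA /finite_index_reps[s sA' sP].
exists (undup [seq coset_rep B y | y <- s]); split; first exact: undup_uniq.
- move=> x /sP[y ys Byx]; rewrite mem_undup.
  by apply/mapP; exists y => //; apply/esym/eq_coset_rep.
- move=> _ /[!mem_undup] /mapP[y ys ->].
  by split; [apply: coset_rep_in => //; exact: sA'|rewrite coset_repK].
Qed.

Definition core A B := [set x | forall g, A g -> B (x ^ g)].

Lemma subgroup_core A B : subgroup B -> subgroup (core A B).
Proof.
move=> [B1 BM BV]; split=> [g _|x y cx cy g Ag|x cx g Ag].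
- by rewrite conj1g.
- by rewrite conjMg; apply: (BM); [exact: cx|exact: cy].
- by rewrite conjVg; apply/BV/cx.
Qed.

Lemma core_conj A B x g : subgroup A -> A g -> core A B x -> core A B (x ^ g).
Proof. by move=> [_ AM _] Ag cx h Ah; rewrite -conjgM; apply/cx/AM. Qed.

Lemma core_sub A B : subgroup A -> core A B `<=` B.
Proof. by move=> [A1 _ _] x /(_ _ A1); rewrite conjg1. Qed.

(** Colour [x] by the colours of [x * z] for finitely many coset representatives [z]. Equal colours
    put [(x^-1 * y) ^ z] in [B] for each [z], and any [g] in [A] differs from some [z] by an element
    of [B] on the right. *)
Lemma finite_index_core A B : subgroup A -> subgroup B ->
  finite_index A B -> finite_index A (core A B).
Proof.
move=> [A1 AM AV] [B1 BM BV] fAB.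
have [s sA sP] := finite_index_reps fAB; have [T [k kP]] := fAB.
exists {ffun 'I_(size s) -> T},
  (fun x => [ffun i : 'I_(size s) => k (x * nth 1 s i)]).
move=> x y Ax Ay exy g Ag; have [z zs Bz] := sP g Ag.
have iz : (index z s < size s)%N by rewrite index_mem.
have := congr1 (fun f : {ffun 'I_(size s) -> T} => f (Ordinal iz)) exy.
rewrite !ffunE /= nth_index// => /kP Bxy.
have {}Bxy : B ((x^-1 * y) ^ z).
  have := Bxy (AM _ _ Ax (sA _ zs)) (AM _ _ Ay (sA _ zs)).
  by rewrite conjgE invgM !mulgA.
have -> : (x^-1 * y) ^ g = ((x^-1 * y) ^ z) ^ (z^-1 * g).
  by rewrite -conjgM mulVKg.
by rewrite conjgE; apply: (BM); [exact: BV|exact: BM].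
Qed.

(** * Subgroups generated by a set *)

Inductive generated A : set G :=
| generated1 : generated A 1
| generatedM x y : A x -> generated A y -> generated A (x * y).

Lemma mem_generated A : A `<=` generated A.
Proof.
by move=> x Ax; rewrite -[x]mulg1; apply: generatedM => //; exact: generated1.
Qed.

(** [generated] has no constructor for inverses and is in general only a submonoid; inverses of
    words are words because [A] is stable under inversion. *)
Lemma subgroup_generated A :
  (forall x, A x -> A x^-1) -> subgroup (generated A).
Proof.
move=> AV; have gM x y : generated A x -> generated A y -> generated A (x * y).
  elim=> [|a b Aa _ IH]; first by rewrite mul1g.
  by move=> /IH; rewrite -mulgA; exact: generatedM.
split=> //; first exact: generated1.
move=> x; elim=> [|a b Aa _ IH]; first by rewrite invg1; exact: generated1.
by rewrite invgM; apply: (gM) => //; exact/mem_generated/AV.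
Qed.

(** The cosets [y M] with [y] in [s] include [M] itself and are carried into one another by left
    multiplication by generators, so induction on words shows that they cover everything. *)
Lemma generated_cover A M s : subgroup M ->
  (exists2 y, y \in s & M y) ->
  (forall x y, A x -> y \in s -> exists2 z, z \in s & M (z^-1 * (x * y))) ->
  forall g, generated A g -> exists2 y, y \in s & M (y^-1 * g).
Proof.
move=> [_ MM MV] [y0 y0s My0] sP g; elim=> [|x h Ax _ [y ys My]].
  by exists y0 => //; rewrite mulg1; exact: MV.
have [z zs Mz] := sP x y Ax ys; exists z => //.
by have := MM _ _ Mz My; rewrite ?gnorm.
Qed.

(** * Finitely generated abelian subgroups *)

Fixpoint span (s : seq G) : set G :=
  if s is e :: s' then
    [set x | exists i j y, span s' y /\ x = e ^+ i * e ^- j * y]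
  else [set 1].

Lemma span_min B s : subgroup B -> (forall x, x \in s -> B x) -> span s `<=` B.
Proof.
move=> sB; case: (sB) => [B1 BM BV]; have BX x n : B x -> B (x ^+ n).
  by move=> Bx; elim: n => // n IH; rewrite expgS; exact: BM.
elim: s => [_ x ->//|e s IH es x [i [j [y [sy ->]]]]].
have Be : B e by apply: es; exact: mem_head.
by apply: (BM); [apply: (BM); [|apply: BV]; exact: BX|
  apply: IH sy => z zs; apply: es; rewrite inE zs orbT].
Qed.

Lemma span_cons e s x : span s x -> span (e :: s) x.
Proof. by move=> sx; exists 0%N, 0%N, x; rewrite !expg0 invg1 !mul1g. Qed.

Lemma span1 s : span s 1.
Proof. by elim: s => // e s; exact: span_cons. Qed.

Lemma mem_span s x : x \in s -> span s x.
Proof.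
elim: s => // e s IH; rewrite inE => /predU1P[->|/IH]; last exact: span_cons.
by exists 1%N, 0%N, 1; rewrite expg0 invg1 expg1 !mulg1; split => //; exact: span1.
Qed.

Section Commuting.
Variable s : seq G.
Hypothesis cs : {in s &, forall x y, commute x y}.

Lemma span_centralised x y :
  (forall z, z \in s -> commute x z) -> span s y -> commute x y.
Proof.
move=> cx; apply: (@span_min [set y | commute x y]) => //.
split=> [|a b|a] /=; [exact: commute1|exact: commuteM|exact: commuteV].
Qed.

Lemma span_commute x y : span s x -> span s y -> commute x y.
Proof.
move=> sx; apply: span_centralised => z zs; apply/commute_sym.
by apply: span_centralised sx => t; exact: cs.
Qed.
End Commuting.

Lemma commute_cons e s : {in e :: s &, forall x y, commute x y} ->
  {in s &, forall x y, commute x y} /\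
  (forall y, span s y -> commute e y).
Proof.
move=> cs; split=> [x y xs ys|y].
  by apply: cs; rewrite inE ?xs ?ys orbT.
apply: span_centralised => z zs; apply: cs; rewrite inE ?eqxx//.
by rewrite zs orbT.
Qed.

(** The two natural exponents [i] and [j] in [span] stand for the integer exponent $i-j$; for a
    commuting list this gives the subgroup generated by [s]. *)
Lemma subgroup_span s :
  {in s &, forall x y, commute x y} -> subgroup (span s).
Proof.
elim: s => [_|e s IH /commute_cons[cs ce]].
  by split=> //= [x y -> ->|x ->]; rewrite ?mulg1 ?invg1.
have [S1 SM SV] := IH cs; split; first exact: span1.
- move=> _ _ [i [j [x [sx ->]]]] [k [l [y [sy ->]]]].
  exists (i + k)%N, (j + l)%N, (x * y); split; first exact: SM.
  have cex : commute x (e ^+ k * e ^- l).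
    apply/commute_sym; apply/commute_sym/commuteM; last apply/commuteV;
    by apply/commuteX/commute_sym/ce.
  have cee : commute (e ^- j) (e ^+ k).
    by apply/commute_sym/commuteV/commuteX2/commute_refl.
  rewrite (addnC j) !expgnDr invgM !mulgA; congr (_ * y).
  transitivity (e ^+ i * e ^- j * (x * (e ^+ k * e ^- l))); first by rewrite !mulgA.
  rewrite cex !mulgA; congr (_ * x); congr (_ * e ^- l).
  by rewrite -!mulgA; congr (_ * _).
- move=> _ [i [j [x [sx ->]]]]; exists j, i, x^-1; split; first exact: SV.
  rewrite !invgM invgK.
  have cex : commute x^-1 (e ^+ j * e ^- i).
    apply/commute_sym/commuteV/commute_sym; apply/commuteM; last apply/commuteV;
    by apply/commuteX/commute_sym/ce.
  by rewrite cex.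
Qed.

(** Induction on the generators. If a positive power [e ^+ a] lies in the span of the others, the
    exponent grows by the factor [a]; otherwise [e] has infinite order modulo that span, and a
    torsion element has exponent zero in [e]. *)
Lemma span_torsion s : {in s &, forall x y, commute x y} ->
  exists2 k, (0 < k)%N &
    forall x r, span s x -> (0 < r)%N -> x ^+ r = 1 -> x ^+ k = 1.
Proof.
elim: s => [_|e s IH /[dup] ces /commute_cons[cs ce]].
  by exists 1%N => // x r ->; rewrite expg1.
have [S1 SM SV] := subgroup_span cs; have [k k0 kP] := IH cs.
have SX x n : span s x -> span s (x ^+ n).
  by move=> sx; elim: n => // n IHn; rewrite expgS; exact: SM.
have cE i j y : span s y -> commute (e ^+ i * e ^- j) y.
  move=> sy; apply/commute_sym/commuteM; last apply/commuteV;
  by apply/commuteX/commute_sym/ce.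
have ee i j n : (e ^+ i * e ^- j) ^+ n = e ^+ (i * n) * e ^- (j * n).
  rewrite expgMn; last by apply/commuteV/commuteX2/commute_refl.
  by rewrite -expgnA expVgn -expgnA.
have [[a a0 ea]|noe] := pselect (exists2 a, (0 < a)%N & span s (e ^+ a)).
  exists (a * k)%N; first by rewrite muln_gt0 a0.
  move=> _ r [i [j [y [sy ->]]]] r0 xr; rewrite expgnA; apply: (kP _ r) => //.
    rewrite expgMn; last exact: cE.
    apply: (SM); last exact: SX.
    by rewrite ee mulnC expgnA mulnC expgnA; apply: (SM); [exact: SX|apply/SV/SX].
  by rewrite -!expgnA mulnC expgnA xr expg1n.
exists k => // _ r [i [j [y [sy ->]]]] r0; move: sy.
move=> sy xr; have : (e ^+ i * e ^- j) ^+ r = (y ^+ r)^-1.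
  by move: xr; rewrite expgMn; [move=> /mulg1_eq <-; rewrite invgK|exact: cE].
rewrite ee => eij.
have seij : span s (e ^+ (i * r) * e ^- (j * r)) by rewrite eij; apply/SV/SX.
have ij : i = j.
  apply/eqP; apply: contrapT => /negP; rewrite neq_ltn => /orP[ij|ij].
  - apply: noe; exists (j * r - i * r)%N; first by rewrite subn_gt0 ltn_pmul2r.
    by rewrite expgnFr ?leq_pmul2r ?(ltnW ij)//; have := SV _ seij; rewrite ?gnorm.
  - apply: noe; exists (i * r - j * r)%N; first by rewrite subn_gt0 ltn_pmul2r.
    by rewrite expgnFr ?leq_pmul2r ?(ltnW ij).
by rewrite ij mulgV mul1g; apply: (kP _ r sy r0); move: xr; rewrite ij mulgV mul1g.
Qed.

Definition powers k A := [set x | exists2 y, A y & x = y ^+ k].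

Lemma subgroup_powers k A : {in A &, forall x y, commute x y} ->
  subgroup A -> subgroup (powers k A).
Proof.
move=> cA [A1 AM AV]; split=> [|_ _ [x Ax ->] [y Ay ->]|_ [x Ax ->]].
- by exists 1 => //; rewrite expg1n.
- exists (x * y); first exact: AM.
  by rewrite expgMn//; apply: cA; exact/mem_set.
- by exists x^-1; [exact: AV|rewrite expVgn].
Qed.

Lemma finite_index_span_powers k s : {in s &, forall x y, commute x y} ->
  (0 < k)%N -> finite_index (span s) (powers k (span s)).
Proof.
move=> cs k0.
suff [t tP] : exists t : seq G, forall x, span s x ->
    exists z y, [/\ z \in t, span s z, span s y & x = z * y ^+ k].
  apply: (@finite_index_cover _ _ t).
    apply: subgroup_powers; last exact: subgroup_span.
    by move=> x y /set_mem sx /set_mem sy; exact: span_commute sx sy.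
  move=> x /tP[z [y [zt _ sy ->]]]; exists z => //.
  by exists y => //; rewrite mulKg.
elim: s cs => [_|e s IH /[dup] ces /commute_cons[cs ce]].
  exists [:: 1] => x ->; exists 1, 1; split=> //; first exact: mem_head.
  by rewrite expg1n mulg1.
have [t tP] := IH cs.
exists [seq e ^+ i * z | i <- iota 0 k, z <- t].
move=> _ [i [j [_ [/tP[z [y [zt sz sy ->]]] ->]]]].
(* Since $-j \equiv (k-1)j$ modulo $k$, the natural number $i+(k-1)j$ has the residue of $i-j$; thus
   $i-j = a + k(q-j)$. *)
pose q := ((i + k.-1 * j) %/ k)%N; pose a := ((i + k.-1 * j) %% k)%N.
exists (e ^+ a * z), (e ^+ q * e ^- j * y); split.
- by apply/allpairsP; exists (a, z); split=> //=; rewrite mem_iota ltn_mod.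
- by exists a, 0%N, z; rewrite expg0 invg1 mulg1.
- by exists q, j, y.
have ec n m w : span s w -> commute (e ^+ n * e ^- m) w.
  move=> sw; apply/commute_sym/commuteM; last apply/commuteV;
  exact/commuteX/commute_sym/ce.
rewrite expgMn; last exact: ec.
rewrite expgMn; last by apply/commuteV/commuteX2/commute_refl.
rewrite expVgn -!expgnA mulgA; rewrite mulgA; congr (_ * _).
rewrite -(mulgA (e ^+ a) z) -(ec _ _ _ sz) mulgA; congr (_ * _).
rewrite mulgA -expgnDr addnC -divn_eq -{2}(prednK k0) mulnS (mulnC j).
by rewrite !expgnDr invgM mulgA mulgK.
Qed.

End AbstractGroups.

(** * Homomorphisms of abstract groups *)

Lemma morphismV (G K : groupType) (f : G -> K) x :
  monoid_morphism f -> f x^-1 = (f x)^-1.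
Proof. by move=> [f1 fM]; apply/esym/mulg1_eq; rewrite -fM mulgV. Qed.

Lemma morphismJ (G K : groupType) (f : G -> K) x y :
  monoid_morphism f -> f (x ^ y) = f x ^ f y.
Proof. by move=> mf; have [_ fM] := mf; rewrite !conjgE !fM morphismV. Qed.

Lemma monoid_morphism_comp (G K L : groupType) (f : G -> K) (g : K -> L) :
  monoid_morphism f -> monoid_morphism g -> monoid_morphism (g \o f).
Proof. by move=> [f1 fM] [g1 gM]; split=> [|x y] /=; rewrite ?f1 ?fM. Qed.

Lemma subgroup_preimage (G K : groupType) (f : G -> K) (A : set K) :
  monoid_morphism f -> subgroup A -> subgroup (f @^-1` A).
Proof.
move=> mf; have [f1 fM] := mf; move=> [A1 AM AV].
split=> /= [|x y|x]; rewrite ?f1 ?fM ?morphismV //; [exact: AM|exact: AV].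
Qed.

Lemma subgroup_range (G K : groupType) (f : G -> K) :
  monoid_morphism f -> subgroup (range f).
Proof.
move=> mf; have [f1 fM] := mf.
split=> [|_ _ [x _ <-] [y _ <-]|_ [x _ <-]].
- by exists 1.
- by exists (x * y).
- by exists x^-1; rewrite ?morphismV.
Qed.

(** * Open subgroups of compact groups *)

Lemma filter_forall_seq (T : Type) (I : eqType) (F : set_system T) {FF : Filter F}
    (s : seq I) (P : I -> set T) :
  (forall i, i \in s -> F (P i)) -> F [set x | forall i, i \in s -> P i x].
Proof.
elim: s => [_|i s IH FP]; first by apply: filterS filterT.
have Fi := FP i (mem_head _ _).
have Fs : F [set x | forall i, i \in s -> P i x].
  by apply: IH => k ks; apply: FP; rewrite inE ks orbT.
apply: filterS (filterI Fi Fs) => x [Pi Ps] k.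
by rewrite inE => /predU1P[->|/Ps].
Qed.

Section TopologicalGroups.
Context {G : topologicalGroupType}.
Implicit Types (A B : set G) (x y : G).

Lemma lmulg_continuous x : continuous (fun y => x * y).
Proof.
move=> y A /(@mulg_continuous G (x, y))[[B C] /= [nB nC] BC].
apply: filterS nC => z Cz; apply: (BC (x, z)); split => //.
exact: nbhs_singleton nB.
Qed.

Lemma rmulg_continuous x : continuous (fun y => y * x).
Proof.
move=> y A /(@mulg_continuous G (y, x))[[B C] /= [nB nC] BC].
apply: filterS nB => z Bz; apply: (BC (z, x)); split => //.
exact: nbhs_singleton nC.
Qed.

Lemma conjg_continuous x : continuous (fun y => y ^ x).
Proof.
move=> y; apply: (@continuous_comp _ _ _ (fun y => y * x) (fun y => x^-1 * y)).
- exact: rmulg_continuous.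
- exact: lmulg_continuous.
Qed.

Lemma nbhs_lmulg x y A : nbhs (x * y) A -> nbhs y [set z | A (x * z)].
Proof. exact: lmulg_continuous. Qed.

Lemma nbhs_mulKg x A : nbhs 1 A -> nbhs x [set z | A (x^-1 * z)].
Proof. by move=> nA; apply: nbhs_lmulg; rewrite mulVg. Qed.

Definition open_subgroup A := subgroup A /\ nbhs 1 A.

Lemma open_subgroup_open A : open_subgroup A -> open A.
Proof.
move=> [[A1 AM AV] nA]; rewrite openE => x Ax.
apply: filterS (nbhs_mulKg x nA) => y Ay.
by rewrite -[y](mulVKg x); apply: (AM).
Qed.

Lemma open_subgroupI A B :
  open_subgroup A -> open_subgroup B -> open_subgroup (A `&` B).
Proof.
by move=> [sA nA] [sB nB]; split; [exact: subgroupI|exact: filterI].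
Qed.

Hypothesis cG : compact [set: G].

Lemma open_subgroup_finite_index A : open_subgroup A -> finite_index [set: G] A.
Proof.
move=> oA; have [sA nA] := oA; have [A1 _ _] := sA.
(* [G] is pointed at the identity so that compactness can be used through open covers; the cover is
   the one by left cosets of [A]. *)
pose PG : ptopologicalType := HB.pack G (isPointed.Build G 1).
have cPG : @compact PG setT := cG.
move: cPG; rewrite compact_cover => /(_ G setT (fun x => [set y | A (x^-1 * y)])).
case=> [x _|x _|D _ DP].
- by apply: open_comp (open_subgroup_open oA) => y _; exact: lmulg_continuous.
- by exists x => //=; rewrite mulVg.
apply: (@finite_index_cover _ _ _ (enum_fset D)).
  exact: sA.
move=> x _.
by have [y yD Ay] := DP x I; exists y.
Qed.

(** Conjugating by representatives of the finitely many cosets of [A] suffices, so the core is a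
    finite intersection of open subgroups. *)
Lemma open_subgroup_core A : open_subgroup A -> open_subgroup (core setT A).
Proof.
move=> oA; have [sA nA] := oA; split; first exact: subgroup_core.
have [s _ sP] := finite_index_reps (open_subgroup_finite_index oA).
apply: (@filterS _ _ _ [set x | forall y, y \in s -> A (x ^ y)]).
  move=> x xs g _; have [y ys Ay] := sP g I; case: sA => A1 AM AV.
  rewrite -(mulVKg y g) conjgM conjgE.
  by apply: (AM); [exact: AV|apply: (AM) => //; exact: xs].
apply: filter_forall_seq => y _.
by apply: (@conjg_continuous y 1); rewrite conj1g.
Qed.

End TopologicalGroups.

(** A continuous map from a compact space to a Hausdorff one is closed; being injective with open
    range, [f] is then also an open map. *)
Lemma open_mono_nbhs (G K : profiniteGroupType) (f : G -> K) x (A : set G) :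
  open_mono f -> nbhs x A -> nbhs (f x) (f @` A).
Proof.
move=> [[_ cf] fI of_]; rewrite nbhsE => -[U [oU Ux] UA].
have cU : closed (f @` ~` U).
  apply: compact_closed; first exact: profinite_hausdorff.
  apply: continuous_compact; first exact/continuous_subspaceT.
  by apply: subclosed_compact (@profinite_compact G) _ => //; exact: open_closedC.
have : nbhs (f x) (range f `&` ~` (f @` ~` U)).
  apply: open_nbhs_nbhs; split; first by apply: openI => //; exact: closed_openC.
  by split=> [|[y nUy /fI yx]]; [exists x|apply: nUy; rewrite yx].
apply: filterS => _ [[y _ <-] nUy]; exists y => //; apply: UA.
by apply: contrapT => nUy'; apply: nUy; exists y.
Qed.

Lemma morphism_continuous (G K : topologicalGroupType) (f : G -> K) :
  monoid_morphism f -> (forall A, nbhs 1 A -> nbhs 1 (f @^-1` A)) ->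
  continuous f.
Proof.
move=> [f1 fM] f1c x A nA.
have : nbhs 1 [set z | A (f x * z)] by apply: nbhs_lmulg; rewrite mulg1.
move=> /f1c /(nbhs_mulKg x); apply: filterS => y /=.
by rewrite -fM mulVKg.
Qed.

(** * Extending the topology of an open subgroup *)

(** For injective [j] this says that conjugation by [q] induces a partial map of [H], defined near 1
    and continuous there. It is what makes multiplication continuous once [H] is declared open in
    [Q]. *)
Definition commensurated (H : topologicalGroupType) (Q : groupType) (j : H -> Q)
    (q : Q) := forall A : set H, nbhs 1 A ->
  nbhs 1 [set n | exists2 m, A m & j n ^ q = j m].

(** The hypotheses are bundled with the map because the topological instances on [extension] depend
    on them: finite index gives compactness, injectivity the separation of points, commensuration
    the continuity of the operations. *)
Record extension_data (H : profiniteGroupType) (Q : groupType) := {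
  ext_map :> H -> Q;
  ext_morphism : monoid_morphism ext_map;
  ext_inj : injective ext_map;
  ext_finite_index : finite_index setT (range ext_map);
  ext_commensurated : forall q, commensurated ext_map q }.

(* A copy of [Q], for the topology in which [H] is an open topological subgroup. *)
Definition extension H Q of @extension_data H Q : Type := Q.

Section Extension.
Context {H : profiniteGroupType} {Q : groupType} (j : extension_data H Q).
Local Notation K := (extension j).

HB.instance Definition _ := Group.copy K Q.
HB.instance Definition _ := hasNbhs.Build K
  (fun q => [set A | nbhs (1 : H) [set n | A (q * j n)]]).

Let j1 : j 1 = 1. Proof. by case: (ext_morphism j). Qed.
Let jM x y : j (x * y) = j x * j y. Proof. by case: (ext_morphism j). Qed.
Let jV x : j x^-1 = (j x)^-1.
Proof. exact: morphismV (ext_morphism j). Qed.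

Lemma extension_nbhsE (q : K) (A : set K) :
  nbhs q A = nbhs (1 : H) [set n | A (q * j n)].
Proof. by []. Qed.

Lemma extension_nbhs_filter (q : K) : ProperFilter (nbhs q).
Proof.
split; first by rewrite extension_nbhsE => /nbhs_singleton.
split=> [|A B nA nB|A B AB]; rewrite extension_nbhsE.
- exact: filterT.
- exact: filterI nA nB.
- by apply: filterS => n; exact: AB.
Qed.

Lemma extension_nbhs_singleton (q : K) (A : set K) : nbhs q A -> A q.
Proof. by move=> /nbhs_singleton; rewrite /= j1 mulg1. Qed.

Lemma extension_nbhs_nbhs (q : K) (A : set K) : nbhs q A -> nbhs q (nbhs^~ A).
Proof.
move=> /nbhs_interior; apply: filterS => n /= nA; rewrite extension_nbhsE.
have := @nbhs_lmulg H n 1; rewrite mulg1 => /(_ _ nA); apply: filterS => m /=.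
by rewrite jM mulgA.
Qed.

HB.instance Definition _ := Nbhs_isNbhsTopological.Build K
  extension_nbhs_filter extension_nbhs_singleton extension_nbhs_nbhs.

(** Moving [j n] across [b] gives $a\,j(n)\,b\,j(p) = ab\,j(n)^b\,j(p)$; commensuration by [b] keeps
    $j(n)^b$ small, and the rest is multiplication in [H]. *)
Lemma extension_mulg_continuous : continuous (fun x : K * K => x.1 * x.2).
Proof.
move=> [a b] A nA.
have nA1 : nbhs (1 * 1 : H) [set n | A (a * b * j n)] by rewrite mulg1.
have [[B C] /= [nB nC] BC] := @mulg_continuous H (1, 1) _ nA1.
exists ([set x | exists n, [/\ exists2 m, B m & j n ^ b = j m & x = a * j n]],
        [set x | exists2 m, C m & x = b * j m]) => /=.
  split; rewrite extension_nbhsE.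
  - by apply: filterS (@ext_commensurated _ _ j b _ nB) => n Bn; exists n.
  - by apply: filterS nC => m Cm; exists m.
move=> [_ _] /= [[n [[m Bm nm] ->]] [p Cp ->]].
have -> : a * j n * (b * j p) = a * b * (j n ^ b * j p).
  by rewrite conjgE !mulgA mulgK.
by rewrite nm -jM; apply: (BC (m, p)).
Qed.

Lemma extension_invg_continuous : continuous (fun x : K => x^-1).
Proof.
move=> a A /(@ext_commensurated _ _ j a^-1) nA.
have nA1 : nbhs (1^-1 : H)
    [set n | exists2 m, A (a^-1 * j m) & j n ^ a^-1 = j m].
  by rewrite invg1.
have nA2 : nbhs (1 : H)
    [set n | exists2 m, A (a^-1 * j m) & j n^-1 ^ a^-1 = j m].
  exact: (@invg_continuous H 1 _ nA1).
apply: filterS nA2 => n [m /= Am nm].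
by move: Am; rewrite -nm conjgE invgK jV invgM ?gnorm.
Qed.

HB.instance Definition _ := isTopologicalGroup.Build K
  extension_mulg_continuous extension_invg_continuous.

Lemma extension_continuous q : continuous (fun n => q * j n : K).
Proof.
move=> n A; rewrite extension_nbhsE => nA; have := nbhs_mulKg n nA.
by apply: filterS => m /=; rewrite -mulgA -jM mulVKg.
Qed.

Lemma extension_open A : nbhs 1 A -> nbhs (1 : K) (j @` A).
Proof.
by rewrite extension_nbhsE; apply: filterS => n An; exists n; rewrite ?mul1g.
Qed.

Let open_subgroup_range : open_subgroup (range j : set K).
Proof.
split; first exact: subgroup_range (ext_morphism j).
by apply: extension_open; exact: filterT.
Qed.

Let coset (q : K) := [set x : K | range j (q^-1 * x)].

Let coset_clopen q : clopen (coset q).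
Proof.
have [[S1 SM SV] _] := open_subgroup_range.
have nS := proj2 open_subgroup_range.
have oC : open (coset q).
  rewrite openE => x qx; apply: filterS (nbhs_mulKg (x : K) nS) => y xy.
  by have := SM _ _ qx xy; rewrite /coset /= ?gnorm.
split=> //; rewrite -[coset q]setCK; apply: open_closedC; rewrite openE => x nx.
apply: filterS (nbhs_mulKg (x : K) nS) => y xy qy.
by apply: nx; have := SM _ _ qy (SV _ xy); rewrite /coset /= ?gnorm.
Qed.

Lemma extension_compact : compact [set: K].
Proof.
have [s _ sP] := finite_index_reps (ext_finite_index j).
suff -> : [set: K] = \big[setU/set0]_(q <- s) ((fun n => q * j n : K) @` setT).
  apply: bigsetU_compact => q _; apply: continuous_compact.
    exact/continuous_subspaceT/extension_continuous.
  exact: profinite_compact.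
apply/seteqP; split=> // x _; have [q qs [n _ jn]] := sP x I.
by rewrite -bigcup_seq; exists q => //; exists n => //; rewrite jn mulVKg.
Qed.

(** Points that cannot be separated lie in a common coset of [H], since cosets are clopen; inside
    the coset, left translation reduces the question to [H]. *)
Lemma extension_hausdorff : hausdorff_space K.
Proof.
move=> x y xy; have [_ cC] := coset_clopen x.
have [[S1 SM SV] nS] := open_subgroup_range.
have [n _ jn] : coset x y.
  apply: contrapT => nxy.
  have [z [xz]] := xy _ _ (nbhs_mulKg x nS)
    (open_nbhs_nbhs (conj (closed_openC cC) nxy)).
  exact.
have yE : y = x * j n by rewrite jn mulVKg.
suff n1 : 1 = n by rewrite yE -n1 j1 mulg1.
apply: (@profinite_hausdorff H) => A B nA nB.
pose D (E : set H) : set K := [set z | exists2 m, E m & z = x * j m].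
have [||z [[m Am zm] [p Bp zp]]] := xy (D A) (D B).
- by rewrite extension_nbhsE; apply: filterS nA => m Am; exists m.
- rewrite extension_nbhsE; have := @nbhs_lmulg H n 1; rewrite mulg1.
  move=> /(_ _ nB); apply: filterS => m Bm; exists (n * m) => //.
  by rewrite yE -mulgA jM.
- exists m; split=> //; suff -> : m = p by [].
  by apply: (@ext_inj _ _ j); apply: (mulgI x); rewrite -zm zp.
Qed.

(** The component of [x] stays in the clopen coset of [x]; translated back to [H] it is a connected
    set containing 1, hence trivial. *)
Lemma extension_totally_disconnected : totally_disconnected [set: K].
Proof.
move=> x _; apply/seteqP; split=> [z Sz|_ ->]; last first.
  exact: connected_component_refl.
set S := connected_component setT x in Sz.
have cS : connected S by exact: component_connected.
have Sx : S x by exact: connected_component_refl.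
have [oC cC] := coset_clopen x.
have SC : S `&` coset x = S.
  apply: cS; [|by exists (coset x)|by exists (coset x)].
  by exists x; split=> //; exists 1 => //; rewrite j1 mulVg.
have SE y : S y -> exists n, y = x * j n.
  by rewrite -SC => -[_ [n _ jn]]; exists n; rewrite jn mulVKg.
pose S' := [set n | S (x * j n)].
(* The map [f] below is open by the choice of topology and closed by compactness, so it carries a
   relatively clopen subset of [S'] to one of [S]. *)
have cS' : connected S'.
  move=> B [b Bb] [C oC' BC] [D cD BD].
  pose f n : K := x * j n.
  have fI : injective f by move=> m n /mulgI/(@ext_inj _ _ j).
  have fS E : B = S' `&` E -> f @` B = S `&` f @` E.
    move=> BE; apply/seteqP; split=> [_ [n Bn <-]|y [Sy [n En ny]]].
      by move: Bn; rewrite BE => -[Sn En]; split=> //; exists n.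
    by exists n => //; rewrite BE; split=> //; move: Sy; rewrite -ny.
  suff fBS : f @` B = S.
    apply/seteqP; split=> n; first by rewrite BC => -[].
    by move=> Sn; have : S (f n) by []; rewrite -fBS => -[m Bm /fI <-].
  apply: cS; first by exists (f b), b.
  - exists (f @` C); last exact: fS.
    rewrite openE => _ [n Cn <-]; rewrite /interior extension_nbhsE.
    have nC : nbhs n C by exact: open_nbhs_nbhs.
    have := @nbhs_lmulg H n 1; rewrite mulg1 => /(_ _ nC).
    by apply: filterS => m Cm; exists (n * m) => //; rewrite /f -mulgA jM.
  - exists (f @` D); last exact: fS.
    apply: compact_closed; first exact: extension_hausdorff.
    apply: continuous_compact.
      exact/continuous_subspaceT/extension_continuous.
    by apply: subclosed_compact (@profinite_compact H) _.
have [n zn] := SE z Sz.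
have S1 : S' 1 by rewrite /S' /= j1 mulg1.
suff : connected_component setT (1 : H) n.
  by rewrite profinite_totally_disconnected// => n1; rewrite zn n1 j1 mulg1.
by exists S' => //; rewrite /S' /= -zn.
Qed.

HB.instance Definition _ := isProfinite.Build K
  extension_compact extension_hausdorff extension_totally_disconnected.

End Extension.

(** * Completions from abstract groups *)

Lemma commensuratedM (H : topologicalGroupType) (Q : groupType)
    (j : H -> Q) q r :
  commensurated j q -> commensurated j r -> commensurated j (q * r).
Proof.
move=> cq cr A /cr /cq; apply: filterS => n [m [p Ap mp] nm].
by exists p => //; rewrite conjgM nm.
Qed.

(** In [G] the range of [iota] is open and conjugation by [x] is continuous, so small elements of
    [H] are conjugated into the image of [A]; [h] transports this to [Q]. *)
Lemma commensurated_morphism (H G : profiniteGroupType) (Q : groupType)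
    (iota : H -> G) (h : G -> Q) x :
  open_mono iota -> monoid_morphism h -> commensurated (h \o iota) (h x).
Proof.
move=> oi mh A /(open_mono_nbhs oi); have [[[i1 iM] ci] _ _] := oi.
rewrite i1 => nA.
have nA' : nbhs (iota 1) [set y | (iota @` A) (y ^ x)].
  by rewrite i1; apply: (@conjg_continuous _ x 1); rewrite conj1g.
have {nA'} : nbhs (1 : H) [set n | (iota @` A) (iota n ^ x)] by exact: ci nA'.
apply: filterS => n [m Am mE]; exists m => //=.
by rewrite mE morphismJ.
Qed.

Lemma generated_commensurated (H G1 G2 : profiniteGroupType) (Q : groupType)
    (iota1 : H -> G1) (iota2 : H -> G2) (h1 : G1 -> Q) (h2 : G2 -> Q) :
  commensuration iota1 iota2 -> monoid_morphism h1 -> monoid_morphism h2 ->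
  h1 \o iota1 = h2 \o iota2 ->
  forall q, generated (range h1 `|` range h2) q ->
    commensurated (h1 \o iota1) q.
Proof.
move=> [oi1 oi2] mh1 mh2 hE q; elim=> [|x y hx _ cy].
  have [h11 _] := mh1; rewrite -h11; exact: commensurated_morphism.
apply: commensuratedM cy; case: hx => -[z _ <-].
- exact: commensurated_morphism.
- by rewrite hE; exact: commensurated_morphism.
Qed.

Lemma extension_open_mono (H G : profiniteGroupType) (Q : groupType)
    (d : extension_data H Q) (iota : H -> G) (h : G -> Q) :
  open_mono iota -> monoid_morphism h -> injective h -> h \o iota = d ->
  open_mono (h : G -> extension d).
Proof.
move=> oi mh hI hd; have [[[i1 _] _] _ _] := oi.
split=> //; first split=> //.
  apply: morphism_continuous => // A; rewrite extension_nbhsE => nA.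
  have := open_mono_nbhs oi nA; rewrite i1; apply: filterS => _ [n An <-].
  by move: An; rewrite -hd /= mul1g.
apply: open_subgroup_open; split; first exact: subgroup_range.
apply: (@filterS _ (nbhs (1 : extension d)) _ (d @` setT)).
  by move=> _ [n _ <-]; exists (iota n) => //; rewrite -hd.
by apply: extension_open; exact: filterT.
Qed.

(** This reduces the search for a completion to abstract groups: since [Q] is generated by the two
    images, all its elements commensurate [H], and [extension] supplies the profinite topology. *)
Lemma extension_completion (H G1 G2 : profiniteGroupType) (Q : groupType)
    (iota1 : H -> G1) (iota2 : H -> G2) (j1 : G1 -> Q) (j2 : G2 -> Q) :
  commensuration iota1 iota2 ->
  monoid_morphism j1 -> injective j1 -> monoid_morphism j2 -> injective j2 ->
  j1 \o iota1 = j2 \o iota2 ->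
  finite_index setT (range (j1 \o iota1)) ->
  (forall q, generated (range j1 `|` range j2) q) ->
  admits_completion iota1 iota2.
Proof.
move=> co mj1 ij1 mj2 ij2 jE fi gen; have [oi1 oi2] := co.
have [[mi1 _] iI _] := oi1.
pose d := @Build_extension_data H Q (j1 \o iota1) (monoid_morphism_comp mi1 mj1)
  (inj_comp ij1 iI) fi (fun q => generated_commensurated co mj1 mj2 jE (gen q)).
exists (extension d), j1, j2; split=> //.
- exact: (extension_open_mono oi1).
- by apply: (extension_open_mono oi2) => //; rewrite -jE.
Qed.

(** * An open subgroup with finite outer action *)

(** The quotient $A/F$ is carried by the chosen coset representatives lying in [A]. The map [q] is
    total on [G], with the identity as default value outside [A]. *)
Lemma subquotient (G : groupType) (A F : set G) :
  subgroup A -> subgroup F -> F `<=` A ->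
  (forall x g, F x -> A g -> F (x ^ g)) ->
  exists (Q : groupType) (q : G -> Q),
    [/\ forall x y, A x -> A y -> q (x * y) = q x * q y,
        forall x y, A x -> A y -> q x = q y <-> F (x^-1 * y) &
        forall z, exists2 x, A x & z = q x].
Proof.
move=> sA sF FA Fn; have [A1 AM AV] := sA; have [F1 FM FV] := sF.
pose S := {x : G | `[< A x /\ coset_rep F x = x >]}.
pose r := coset_rep F.
have rA x : A x -> `[< A (r x) /\ coset_rep F (r x) = r x >].
  move=> Ax; apply/asboolP; rewrite /r coset_repK //; split=> //.
  exact: (coset_rep_in sA sF FA).
pose one : S := exist _ (r 1) (rA 1 A1).
pose q x : S := insubd one (r x).
have qE x : A x -> val (q x) = r x by move=> /rA Ax; rewrite insubdK.
have SA (x : S) : A (val x) /\ r (val x) = val x.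
  by case: x => x /= /asboolP.
have qS (x : S) : q (val x) = x.
  by apply: val_inj; have [Ax rx] := SA x; rewrite qE.
have rF x y : F (x^-1 * y) -> r x = r y by exact: eq_coset_rep.
have rP x : F (x^-1 * r x) by exact: coset_repP.
have qP x y : A x -> A y -> q x = q y <-> F (x^-1 * y).
  move=> Ax Ay; split=> [/(congr1 val)|Fxy]; last first.
    by apply: val_inj; rewrite !qE //; exact: rF.
  rewrite !qE // => rxy; have := FM _ _ (rP x) (FV _ (rP y)).
  by rewrite rxy ?gnorm.
pose mul (x y : S) := q (val x * val y).
have mulE x y : A x -> A y -> mul (q x) (q y) = q (x * y).
  move=> Ax Ay; have [Ar As] : A (r x) /\ A (r y).
    by split; exact: (coset_rep_in sA sF FA).
  rewrite /mul !qE //; apply/qP; [exact: AM|exact: AM|].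
  have /= := FM _ _ (FV _ (rP y)) (Fn _ y (FV _ (rP x)) Ay).
  by rewrite conjgE ?gnorm.
have qmul x y : A x -> A y -> q (x * y) = mul (q x) (q y).
  by move=> Ax Ay; rewrite mulE.
pose inv (x : S) := q (val x)^-1.
have surj (z : S) : exists2 x, A x & z = q x.
  by exists (val z); [case: (SA z)|rewrite qS].
have mA : associative mul.
  move=> x y z; have [a Aa ->] := surj x; have [b Ab ->] := surj y.
  have [c Ac ->] := surj z.
  by rewrite !mulE ?mulgA //; exact: AM.
have oneE : one = q 1 by apply: val_inj; rewrite qE.
have m1 : left_id one mul.
  by move=> x; have [a Aa ->] := surj x; rewrite oneE mulE ?mul1g.
have m1' : right_id one mul.
  by move=> x; have [a Aa ->] := surj x; rewrite oneE mulE ?mulg1.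
have mV : left_inverse one inv mul.
  move=> x; have [Ax _] := SA x; rewrite -{2}[x]qS /inv mulE ?mulVg //.
  exact: AV.
have mV' : right_inverse one inv mul.
  move=> x; have [Ax _] := SA x; rewrite -{1}[x]qS /inv mulE ?mulgV //.
  exact: AV.
pose Q : groupType := HB.pack S (isGroup.Build S mA m1 m1' mV mV').
by exists Q, q.
Qed.

Section FiniteOuterAction.
Context (H : profiniteGroupType) (G : groupType) (eta : H -> G) (X U : set G).
Context (rho : G -> H) (V : set H).
Hypothesis eta_morphism : monoid_morphism eta.
Hypothesis XV : forall x, X x -> X x^-1.
Hypothesis X_cover : exists2 Y : seq G, (forall y, y \in Y -> generated X y) &
  forall x, X x -> exists2 y, y \in Y & range eta (y^-1 * x).
Hypothesis X_commensurated : forall g, generated X g -> commensurated eta g.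
Hypothesis eta_X : range eta `<=` generated X.
Hypothesis subgroupU : subgroup U.
Hypothesis eta_U : range eta `<=` U.
Hypothesis finite_indexU : finite_index (generated X) U.
Hypothesis rhoM : forall u v, U u -> U v -> rho (u * v) = rho u * rho v.
Hypothesis rhoK : forall h, rho (eta h) = h.
Hypothesis oV : open_subgroup V.

Let eta1 : eta 1 = 1. Proof. by case: eta_morphism. Qed.
Let etaM x y : eta (x * y) = eta x * eta y. Proof. by case: eta_morphism. Qed.
Let etaV x : eta x^-1 = (eta x)^-1.
Proof. exact: morphismV. Qed.
Let etaJ x y : eta (x ^ y) = eta x ^ eta y. Proof. exact: morphismJ. Qed.
Let sX : subgroup (generated X). Proof. exact: subgroup_generated. Qed.


(** The preimage under [eta] of $g\,\eta(A)\,g^{-1}$. *)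
Definition pull (A : set H) g := [set n | exists2 m, A m & eta n ^ g = eta m].

Lemma open_subgroup_pull A g :
  generated X g -> open_subgroup A -> open_subgroup (pull A g).
Proof.
move=> Xg [[A1 AM AV] nA]; split; last exact: X_commensurated.
split=> [|x y [n An xn] [m Am ym]|x [n An xn]].
- by exists 1; rewrite ?eta1 ?conj1g.
- by exists (n * m); [exact: AM|rewrite !etaM conjMg xn ym].
- by exists n^-1; [exact: AV|rewrite !etaV conjVg xn].
Qed.

Lemma common_open_subgroup (I : eqType) (s : seq I) (P : I -> set H -> Prop) :
  (forall i A B, P i A -> B `<=` A -> P i B) ->
  (forall i, i \in s -> exists2 A, open_subgroup A & P i A) ->
  exists2 A, open_subgroup A & forall i, i \in s -> P i A.
Proof.
move=> Panti; elim: s => [_|i s IH sP].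
  exists setT => //; split=> //; exact: filterT.
have [A oA PA] := sP i (mem_head _ _).
have [k ks|B oB PB] := IH; first by apply: sP; rewrite inE ks orbT.
exists (A `&` B); first exact: open_subgroupI.
move=> k; rewrite inE => /predU1P[->|/PB PkB].
- by apply: Panti PA _ => ? [].
- by apply: Panti PkB _ => ? [].
Qed.

(** The element [c] below is killed by [rho]. Whenever [c] conjugates [eta n] to some [eta m],
    applying [rho] gives [n = m], so [c] centralises the image of the open subgroup
    [pull setT c]. *)
Lemma retract_centralises u : generated X u -> U u ->
  exists2 A, open_subgroup A &
    forall n, A n -> commute (u * (eta (rho u))^-1) (eta n).
Proof.
have [U1 UM UV] := subgroupU; have [X1 XM XV'] := sX.
move=> Xu Uu; set c := u * _.
have Xc : generated X c.
  by apply: (XM) => //; apply: XV'; apply: eta_X; exists (rho u).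
have Uc : U c by apply: (UM) => //; apply: UV; apply: eta_U; exists (rho u).
have rhoV v : U v -> rho v^-1 = (rho v)^-1.
  move=> Uv; apply/esym/mulg1_eq; rewrite -rhoM ?mulgV; last 2 first.
  - by [].
  - exact: UV.
  by rewrite -eta1 rhoK.
have Ue h : U (eta h) by apply: eta_U; exists h.
have rc : rho c = 1.
  by rewrite /c -etaV rhoM ?rhoK ?mulgV.
clearbody c; exists (pull setT c).
  by apply: open_subgroup_pull => //; split=> //; exact: filterT.
move=> n [m _ nm]; suff nE : n = m.
  by rewrite -nE in nm; rewrite /commute [RHS]conjgC nm.
have UcV : U c^-1 by exact: UV.
have Unc : U (eta n * c) by exact: UM.
have := congr1 rho nm; rewrite rhoK conjgE !(rhoM, rhoK, rhoV)//.
by rewrite rc invg1 mul1g mulg1.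
Qed.

Lemma finite_outer_action : exists N : set H, [/\ open_subgroup N, N `<=` V,
  (forall g n, generated X g -> N n -> pull N g n) &
  exists2 T : seq G, (forall t, t \in T -> generated X t) &
    forall g, generated X g -> exists2 t, t \in T &
      exists h, forall n, N n -> commute (t^-1 * g * eta h) (eta n)].
Proof.
have [U1 UM UV] := subgroupU; have [X1 XM XV'] := sX.
have [T' T'X T'U] := finite_index_reps finite_indexU.
(* Adding 1 lets the coset of the identity be represented by 1 and makes the intersection [N] below
   a subset of [N0]. *)
pose T := 1 :: T'.
have TX t : t \in T -> generated X t by rewrite inE => /predU1P[->|/T'X].
have TU g : generated X g -> exists2 t, t \in T & U (t^-1 * g).
  by move=> /T'U[t tT Ut]; exists t; rewrite // inE tT orbT.
have [Y YX YP] := X_cover.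
have [A oA AP] : exists2 A : set H, open_subgroup A & forall t, t \in T ->
    forall x, X x -> exists2 t', t' \in T &
      exists h, forall n, A n -> commute (t'^-1 * (x * t) * eta h) (eta n).
  apply: common_open_subgroup => [t A B At BA x Xx|t tT].
    have [t' t'T [h hA]] := At x Xx; exists t' => //; exists h => n /BA.
    exact: hA.
  (* A generator has the form [y * eta h]. Splitting [h] as [k] times an element of [pull setT t],
     and moving the latter across [t], leaves the finitely many products [y * eta k * t] to
     control. *)
  have [S _ SP] : exists2 S : seq H, (forall h, h \in S -> setT h) &
      forall h, setT h -> exists2 k, k \in S & pull setT t (k^-1 * h).
    apply: finite_index_reps; apply: open_subgroup_finite_index.
      exact: profinite_compact.
    apply: open_subgroup_pull; first exact: TX.
    by split=> //; exact: filterT.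
  have [A oA AP] : exists2 A : set H, open_subgroup A &
      forall z, z \in [seq y * eta k * t | y <- Y, k <- S] ->
      exists t' c, [/\ t' \in T, range eta (c^-1 * (t'^-1 * z)) &
        forall n, A n -> commute c (eta n)].
    apply: common_open_subgroup => [z A B [t' [c [t'T cz cA]]] BA|z].
      by exists t', c; split=> // n /BA; exact: cA.
    case/allpairsP=> -[y k] /= [yY kS zE].
    have Xz : generated X z.
      rewrite zE; apply: (XM); last exact: TX.
      by apply: (XM); [exact: YX|apply: eta_X; exists k].
    have [t' t'T Ut'] := TU z Xz.
    have [|A oA cA] := @retract_centralises (t'^-1 * z) _ Ut'.
      by apply: (XM) => //; apply: XV'; exact: TX.
    exists A => //; exists t', (t'^-1 * z * (eta (rho (t'^-1 * z)))^-1).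
    split=> //; exists (rho (t'^-1 * z)) => //.
    by rewrite invgM invgK mulgVK.
  exists A => // x Xx; have [y yY [h _ hE]] := YP x Xx.
  have [k kS [m _ mE]] := SP h I.
  have [|t' [c [t'T [l _ lE] cA]]] := AP (y * eta k * t).
    by apply/allpairsP; exists (y, k).
  exists t' => //; exists (m^-1 * l^-1) => n An.
  suff -> : t'^-1 * (x * t) * eta (m^-1 * l^-1) = c by exact: cA.
  have -> : x = y * eta h by rewrite hE mulVKg.
  move: mE; rewrite !(etaM, etaV) conjgE => <-.
  by rewrite lE ?gnorm.
have nA0 : open_subgroup (core setT (A `&` V)).
  by apply: open_subgroup_core; [exact: profinite_compact|exact: open_subgroupI].
set N0 := core setT (A `&` V) in nA0.
have N0J n h : N0 n -> N0 (n ^ h) by apply: core_conj.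
have N0AV n : N0 n -> A n /\ V n by move=> /core_sub; apply.
pose C := [set c | forall n, N0 n -> commute c (eta n)].
have C1 : C 1 by move=> n _; apply/commute_sym/commute1.
have CM c d : C c -> C d -> C (c * d).
  move=> Cc Cd n Nn; apply/commute_sym/commuteM; apply/commute_sym;
  [exact: Cc|exact: Cd].
have CV c : C c -> C c^-1.
  by move=> Cc n Nn; apply/commute_sym/commuteV/commute_sym/Cc.
have CJ c h : C c -> C (c ^ eta h).
  move=> Cc n Nn; have := Cc _ (N0J n h^-1 Nn); rewrite etaJ => cn.
  apply: (@conjg_inj _ (eta h^-1)); rewrite [LHS]conjMg [RHS]conjMg -!conjgM.
  by rewrite -etaM mulgV eta1 conjg1.
(* The elements acting on the image of [N0] as elements of [H] do. They preserve that image, because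
   [N0] is normal in [H]. *)
pose M := [set g | exists h, C (g * eta h)].
have sM : subgroup M.
  split=> [|x y [h Cx] [k Cy]|x [h Cx]].
  - by exists 1; rewrite eta1 mulg1.
  - exists (k * h); rewrite etaM.
    have -> : x * y * (eta k * eta h) = x * eta h * (y * eta k) ^ eta h.
      by rewrite conjgE ?gnorm.
    by apply: CM => //; exact: CJ.
  - exists h^-1; have := CV _ (CJ _ h^-1 Cx).
    by rewrite conjgE etaV ?gnorm.
have TM g : generated X g -> exists2 t, t \in T & M (t^-1 * g).
  apply: generated_cover => //.
    by exists 1; [exact: mem_head|case: sM].
  move=> x t Xx tT; have [t' t'T [h hA]] := AP t tT x Xx.
  by exists t' => //; exists h => n /N0AV[An _]; exact: hA.
(* As the cosets [t M] cover the generated group and [M] preserves the image of [N0], this finite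
   intersection equals the one over all [g]; hence [N] is both open and invariant. *)
pose N := [set n | forall t, t \in T -> pull N0 t n].
have NN0 n : N n -> N0 n.
  move=> /(_ 1 (mem_head _ _))[m Nm]; rewrite conjg1.
  by move=> /(can_inj rhoK) ->.
have oN : open_subgroup N.
  split; last first.
    apply: filter_forall_seq => t tT.
    by have [] := open_subgroup_pull (TX _ tT) nA0.
  split=> [t tT|x y Nx Ny t tT|x Nx t tT];
    have [[P1 PM PV] _] := open_subgroup_pull (TX _ tT) nA0.
  - exact: P1.
  - by apply: PM; [exact: Nx|exact: Ny].
  - by apply: PV; exact: Nx.
have NJ g n : generated X g -> N n -> pull N0 g n.
  move=> Xg Nn; have [t tT [h hC]] := TM g Xg.
  have [m Nm mE] := Nn t tT.
  exists (m ^ h^-1); first exact: N0J.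
  apply: (@conjg_inj _ (eta h)).
  rewrite -etaJ -!conjgM mulVg conjg1 -[g](mulVKg t) -!mulgA conjgM mE mulgA.
  exact/conjg_fixP/commgP/commute_sym/hC.
exists N; split=> //.
- by move=> n /NN0/N0AV[].
- move=> g n Xg Nn; have [m Nm mE] := NJ g n Xg Nn.
  exists m => // t tT; have [p Np pE] := NJ (g * t) n (XM _ _ Xg (TX _ tT)) Nn.
  by exists p => //; rewrite -mE -conjgM.
- exists T => // g /TM[t tT [h hC]]; exists t => //.
  by exists h => n /NN0; exact: hC.
Qed.

End FiniteOuterAction.

(** * Amalgamating finite quotients *)

Lemma right_cosets (G : groupType) (B : set G) :
  subgroup B -> finite_index setT B ->
  exists (T : finType) (q : G -> T) (s : T -> G),
    cancel s q /\ forall x y, q x = q y <-> B (x * y^-1).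
Proof.
move=> sB fB; have sT : subgroup [set: G] by [].
have [l [_ lT lP]] := transversal sT sB (subsetT B) fB.
pose q x : seq_sub l := SeqSub (lT x I).
exists (seq_sub l), (fun x => q x^-1), (fun t => (ssval t)^-1); split.
  by move=> [t tl]; apply: val_inj; rewrite /= invgK; case: (lP t tl).
move=> x y; split=> [/(congr1 val)/= xy|xy].
  have [_ BM BV] := sB.
  have := BM _ _ (coset_repP x^-1 sB) (BV _ (coset_repP y^-1 sB)).
  by rewrite xy ?gnorm.
by apply: val_inj; apply: eq_coset_rep; rewrite // invgK.
Qed.

Section InducedAction.
Context (H G : groupType) (iota : H -> G) (N : set H).
Context (B : finType) (qb : H -> B) (sb : B -> H).
Hypothesis iota_morphism : monoid_morphism iota.
Hypothesis iota_inj : injective iota.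
Hypothesis subgroupN : subgroup N.
Hypothesis finite_range : finite_index setT (range iota).
Hypothesis normalN :
  forall x n, N n -> exists2 m, N m & iota n ^ x = iota m.
Hypothesis sbK : cancel sb qb.
Hypothesis qbP : forall x y, qb x = qb y <-> N (x * y^-1).

(** Left multiplication acts on the right cosets of the normal subgroup $\iota(N)$, and stabilisers
    lie in $\iota(N)$. Splitting each coset along the right cosets of $\iota(H)$ makes [H] act on
    the factor [B] only, by a formula independent of [G]. *)
Lemma induced_action : exists (X : finType) (act : G -> B * X -> B * X),
  [/\ act 1 =1 id, forall g g', act (g * g') =1 act g \o act g',
      forall h p, act (iota h) p = (qb (h * sb p.1), p.2),
      exists X0 : X, True & forall g p, act g p = p -> (iota @` N) g].
Proof.
have [i1 iM] := iota_morphism; have [N1 NM NV] := subgroupN.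
have [X [q [s [sK qP]]]] :=
  right_cosets (subgroup_range iota_morphism) finite_range.
have /choice[a aP] : forall y, exists h, y = iota h * s (q y).
  move=> y; have /qP[h _ hE] : q y = q (s (q y)) by rewrite sK.
  by exists h; rewrite hE mulgVK.
pose code y := (qb (a y), q y); pose decode p := iota (sb p.1) * s p.2.
(* [code] identifies the right cosets of [iota N] with [B * X]. *)
have codeK p : code (decode p) = p.
  case: p => b i; rewrite /code.
  have qi : q (decode (b, i)) = i.
    by rewrite -[RHS]sK; apply/qP; exists (sb b); rewrite // /decode mulgK.
  congr (_, _) => //; rewrite -[RHS]sbK; congr qb; apply: iota_inj.
  by have := aP (decode (b, i)); rewrite qi => /mulIg.
have codeN n y : N n -> code (iota n * y) = code y.
  move=> Nn; have qn : q (iota n * y) = q y.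
    by apply/qP; exists n; rewrite // mulgK.
  rewrite /code qn; congr (_, _); apply/qbP.
  suff -> : a (iota n * y) = n * a y by rewrite mulgK.
  have := aP (iota n * y); rewrite qn {1}(aP y) mulgA -iM => /mulIg/iota_inj.
  by move=> ->.
have decodeK y : exists2 n, N n & decode (code y) = iota n * y.
  have /qbP Nn : qb (sb (qb (a y))) = qb (a y) by rewrite sbK.
  exists (sb (qb (a y)) * (a y)^-1) => //.
  by rewrite {4}(aP y) mulgA -iM mulgVK.
exists X, (fun g p => code (g * decode p)); split.
- by move=> p; rewrite mul1g codeK.
- move=> g g' p /=; have [n Nn ->] := decodeK (g' * decode p).
  have [m Nm mE] := normalN g^-1 Nn.
  have -> : g * (iota n * (g' * decode p)) = iota m * (g * g' * decode p).
    by rewrite -mE conjgE invgK ?gnorm.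
  by rewrite codeN.
- move=> h [b i] /=; rewrite -[RHS]codeK.
  have [n Nn E] : exists2 n, N n & sb (qb (h * sb b)) = n * (h * sb b).
    exists (sb (qb (h * sb b)) * (h * sb b)^-1); last by rewrite mulgVK.
    by apply/qbP; rewrite sbK.
  by rewrite /decode /= E iM -[in RHS]mulgA (codeN n) // iM mulgA.
- by exists (q 1).
- move=> g p gp; have [n Nn] := decodeK (g * decode p).
  rewrite gp => E; exists n^-1; first exact: NV.
  rewrite morphismV //; apply/esym/(mulgI (iota n)); apply: (mulIg (decode p)).
  by rewrite -mulgA -E mulgV mul1g.
Qed.
End InducedAction.

(** Permutations compose from left to right, so a left action becomes a homomorphism after
    inversion. *)
Lemma permutation_representation (G : groupType) (T : finType) (act : G -> T -> T) :
  act 1 =1 id -> (forall g g', act (g * g') =1 act g \o act g') ->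
  exists f : G -> {perm T}, monoid_morphism f /\ forall g x, f g x = act g^-1 x.
Proof.
move=> a1 aM; have aK g : cancel (act g^-1) (act g).
  by move=> x; have := aM g g^-1 x; rewrite mulgV a1.
exists (fun g => perm (can_inj (aK g))); split=> [|g x]; last by rewrite permE.
split=> [|g g']; apply/permP => x.
  by rewrite permE perm1 invg1 a1.
by rewrite permM !permE invgM aM.
Qed.

(** On [B * X1 * X2] each group acts through [B] and its own factor and fixes the other one. On [H]
    both actions reduce to left multiplication on [B], so they agree. *)
Lemma finite_amalgam (H G1 G2 : groupType) (iota1 : H -> G1) (iota2 : H -> G2)
    (N : set H) :
  monoid_morphism iota1 -> injective iota1 -> finite_index setT (range iota1) ->
  (forall x n, N n -> exists2 m, N m & iota1 n ^ x = iota1 m) ->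
  monoid_morphism iota2 -> injective iota2 -> finite_index setT (range iota2) ->
  (forall x n, N n -> exists2 m, N m & iota2 n ^ x = iota2 m) ->
  subgroup N -> finite_index setT N ->
  exists (T : finType) (f1 : G1 -> {perm T}) (f2 : G2 -> {perm T}),
    [/\ monoid_morphism f1 /\ monoid_morphism f2, f1 \o iota1 = f2 \o iota2,
        forall n, N n -> f1 (iota1 n) = 1,
        forall x, f1 x = 1 -> (iota1 @` N) x &
        forall x, f2 x = 1 -> (iota2 @` N) x].
Proof.
move=> m1 inj1 fi1 N1 m2 inj2 fi2 N2 sN fN.
have [B [qb [sb [sbK qbP]]]] := right_cosets sN fN.
have [X1 [a1 [a11 a1M a1E [x1 _] a1F]]] :=
  induced_action m1 inj1 sN fi1 N1 sbK qbP.
have [X2 [a2 [a21 a2M a2E [x2 _] a2F]]] :=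
  induced_action m2 inj2 sN fi2 N2 sbK qbP.
pose T := (B * X1 * X2)%type.
pose c1 g (t : T) : T := let: (b, x, y) := t in (a1 g (b, x), y).
pose c2 g (t : T) : T :=
  let: (b, x, y) := t in ((a2 g (b, y)).1, x, (a2 g (b, y)).2).
have [|g g' [[b x] y]|f1 [mf1 f1E]] := @permutation_representation G1 T c1.
- by move=> [[b x] y]; rewrite /c1 a11.
- by rewrite /c1 a1M /=; case: (a1 g' _).
have [|g g' [[b x] y]|f2 [mf2 f2E]] := @permutation_representation G2 T c2.
- by move=> [[b x] y]; rewrite /c2 a21.
- by rewrite /c2 a2M /=; case: (a2 g' _).
have imV (G : groupType) (i : H -> G) g :
    monoid_morphism i -> (i @` N) g^-1 -> (i @` N) g.
  move=> mi [n Nn nE]; exists n^-1; first by case: sN => _ _; apply.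
  by rewrite morphismV // nE invgK.
exists T, f1, f2; split=> //.
- apply/funext => h /=; apply/permP => -[[b x] y].
  by rewrite f1E f2E -(morphismV _ m1) -(morphismV _ m2) /c1 /c2 a1E a2E.
- move=> n Nn; apply/permP => -[[b x] y].
  rewrite f1E -(morphismV _ m1) perm1 /c1 a1E /=.
  suff -> : qb (n^-1 * sb b) = b by [].
  rewrite -[RHS]sbK; apply/qbP; rewrite mulgK.
  by case: sN => _ _; apply.
- move=> g fg; apply: imV => //; apply: (a1F _ (qb 1, x1)).
  have := f1E g (qb 1, x1, x2); rewrite fg perm1 /c1.
  by case: (a1 _ _) => ? ? [<- <-].
- move=> g fg; apply: imV => //; apply: (a2F _ (qb 1, x2)).
  have := f2E g (qb 1, x1, x2); rewrite fg perm1 /c2.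
  by case: (a2 _ _) => ? ? /= [<- <-].
Qed.

(** * An invariant complement *)

Lemma perm_prodg_commute (G : monoidType) (I : eqType) (s t : seq I) (f : I -> G) :
  {in s &, forall i j, commute (f i) (f j)} -> perm_eq s t ->
  \prod_(i <- s) f i = \prod_(i <- t) f i.
Proof.
elim: s t => [|i s IH] t cs st.
  by move: st; rewrite perm_sym => /perm_nilP ->.
have it : i \in t by rewrite -(perm_mem st) mem_head.
case/splitPr: it st => t1 t2 st.
have {}st : perm_eq s (t1 ++ t2).
  by rewrite -(perm_cons i) (perm_trans st) // -cat1s perm_catCA.
 rewrite big_cons (IH (t1 ++ t2)) //; last first.
  by move=> a b sa sb; apply: cs; rewrite inE ?sa ?sb orbT.
rewrite !big_cat big_cons /= !mulgA; congr (_ * _).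
rewrite big_seq; apply: commute_prod => j jt; apply: cs; first exact: mem_head.
by rewrite inE (perm_mem st) mem_cat jt orbT.
Qed.

Section InvariantComplement.
Context (H G : groupType) (eta : H -> G) (X U W : set G) (rho : G -> H).
Context (N : set H).
Local Notation A := (generated X).
Hypothesis eta_morphism : monoid_morphism eta.
Hypothesis XV : forall x, X x -> X x^-1.
Hypothesis X_cover : exists2 Y : seq G, (forall y, y \in Y -> A y) &
  forall x, X x -> exists2 y, y \in Y & range eta (y^-1 * x).
Hypothesis eta_X : range eta `<=` A.
Hypothesis subgroupU : subgroup U.
Hypothesis eta_U : range eta `<=` U.
Hypothesis finite_indexU : finite_index A U.
Hypothesis rhoM : forall u v, U u -> U v -> rho (u * v) = rho u * rho v.
Hypothesis rhoK : forall h, rho (eta h) = h.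
Hypothesis subgroupN : subgroup N.
Hypothesis finite_indexN : finite_index setT N.
Hypothesis normalN : forall g n, A g -> N n -> exists2 m, N m & eta n ^ g = eta m.
Hypothesis outerN : exists2 T : seq G, (forall t, t \in T -> A t) &
  forall g, A g -> exists2 t, t \in T &
    exists h, forall n, N n -> commute (t^-1 * g * eta h) (eta n).
Hypothesis subgroupW : subgroup W.
Hypothesis normalW : forall x g, W x -> A g -> W (x ^ g).
Hypothesis finite_indexW : finite_index A W.
Hypothesis eta_W : eta @` N `<=` W.

Let eta1 : eta 1 = 1. Proof. by case: eta_morphism. Qed.
Let etaM x y : eta (x * y) = eta x * eta y. Proof. by case: eta_morphism. Qed.
Let etaV x : eta x^-1 = (eta x)^-1.
Proof. exact: morphismV. Qed.
Let sA : subgroup A. Proof. exact: subgroup_generated. Qed.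
Let etaA h : A (eta h). Proof. by apply: eta_X; exists h. Qed.
Let etaU h : U (eta h). Proof. by apply: eta_U; exists h. Qed.
Let rho1 : rho 1 = 1. Proof. by rewrite -eta1 rhoK. Qed.
Let rhoV u : U u -> rho u^-1 = (rho u)^-1.
Proof.
have [_ _ UV] := subgroupU.
by move=> Uu; apply/esym/mulg1_eq; rewrite -rhoM ?mulgV //; exact: UV.
Qed.

Let C := [set c | forall n, N n -> commute c (eta n)].

Let subgroupC : subgroup C.
Proof.
split=> [n _|c d Cc Cd n Nn|c Cc n Nn]; apply/commute_sym.
- exact: commute1.
- by apply: commuteM; apply/commute_sym; [exact: Cc|exact: Cd].
- by apply/commuteV/commute_sym/Cc.
Qed.

Let normalC c g : C c -> A g -> C (c ^ g).
Proof.
have [_ _ AV] := sA; move=> Cc Ag n Nn; have [m Nm mE] := normalN (AV _ Ag) Nn.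
have -> : eta n = eta m ^ g by rewrite -mE -conjgM mulVg conjg1.
by rewrite /commute -[LHS]conjMg -[RHS]conjMg (Cc m Nm).
Qed.

Let U1 := [set u | U u /\ N (rho u)].

Let subgroupU1 : subgroup U1.
Proof.
have [V1 UM UV] := subgroupU; have [N1 NM NV] := subgroupN.
split=> [|x y [Ux Nx] [Uy Ny]|x [Ux Nx]]; split=> //.
- by rewrite rho1.
- exact: UM.
- by rewrite rhoM //; exact: NM.
- exact: UV.
- by rewrite rhoV //; exact: NV.
Qed.

Let finite_indexU1 : finite_index A U1.
Proof.
have [_ UM UV] := subgroupU.
have [T _ TP] := finite_index_reps finite_indexU.
have [S _ SP] := finite_index_reps finite_indexN.
apply: (@finite_index_cover _ _ _ [seq t * eta k | t <- T, k <- S]) => // x Ax.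
have [t tT Ut] := TP x Ax; have [k kS Nk] := SP (rho (t^-1 * x)) I.
exists (t * eta k); first by apply/allpairsP; exists (t, k).
rewrite invgM -mulgA -etaV; split; first exact: UM.
by rewrite rhoM // rhoK.
Qed.

(** The core ensures that [rho] is defined, with values in [N], on every conjugate of an element of
    [C0]; the factor [W] places the future complement inside [W]. *)
Let C0 := A `&` C `&` W `&` core A U1.

Let subgroupC0 : subgroup C0.
Proof.
apply: subgroupI; last exact: subgroup_core.
by apply: subgroupI => //; exact: subgroupI.
Qed.

Let C0A c : C0 c -> A c. Proof. by case=> -[[]]. Qed.
Let C0C c : C0 c -> C c. Proof. by case=> -[[]]. Qed.
Let C0U1 c : C0 c -> U1 c. Proof. by case=> _ /core_sub; apply. Qed.
Let C0U c : C0 c -> U c. Proof. by case/C0U1. Qed.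

Let normalC0 c g : C0 c -> A g -> C0 (c ^ g).
Proof.
have [_ AM AV] := sA; move=> [[[Ac Cc] Wc] Uc] Ag; split; first split; first split.
- by rewrite conjgE; apply: (AM); [exact: AV|exact: AM].
- exact: normalC.
- exact: normalW.
- exact: core_conj.
Qed.

(** The image under [eta] of the centre of [N]. *)
Let Z := [set x | exists2 n, N n & C (eta n) /\ x = eta n].

Let ZC0 x : Z x -> C0 x.
Proof.
move=> [n Nn [Cn ->]]; split; first split; first split=> //.
- by apply: eta_W; exists n.
- move=> g Ag; have [m Nm ->] := normalN Ag Nn; split=> //=; by rewrite rhoK.
Qed.

Let subgroupZ : subgroup Z.
Proof.
have [N1 NM NV] := subgroupN; have [C1 CM CV] := subgroupC.
split=> [|_ _ [n Nn [Cn ->]] [m Nm [Cm ->]]|_ [n Nn [Cn ->]]].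
- by exists 1 => //; rewrite eta1.
- by exists (n * m); [exact: NM|rewrite etaM; split=> //; exact: CM].
- by exists n^-1; [exact: NV|rewrite etaV; split=> //; exact: CV].
Qed.

Let normalZ x g : Z x -> A g -> Z (x ^ g).
Proof.
move=> [n Nn [Cn ->]] Ag; have [m Nm mE] := normalN Ag Nn.
by exists m => //; rewrite -mE; split=> //; exact: normalC.
Qed.

Let commuteCZ c x : C c -> Z x -> commute c x.
Proof. by move=> Cc [n Nn [_ ->]]; exact: Cc. Qed.

Let commuteZ x y : Z x -> Z y -> commute x y.
Proof. by move=> /ZC0/C0C; exact: commuteCZ. Qed.

Let p c := eta (rho c).

Let pM c d : C0 c -> C0 d -> p (c * d) = p c * p d.
Proof. by move=> /C0U Uc /C0U Ud; rewrite /p rhoM // etaM. Qed.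

Let pV c : C0 c -> p c^-1 = (p c)^-1.
Proof. by move=> /C0U Uc; rewrite /p rhoV // etaV. Qed.

Let pZ x : Z x -> p x = x.
Proof. by move=> [n _ [_ ->]]; rewrite /p rhoK. Qed.

(** Applying [rho] to the relation between [c] and [eta n] shows that [rho c] commutes with every
    [n] in [N]. *)
Let Zp c : C0 c -> Z (p c).
Proof.
move=> cC0; have [Uc Nc] := C0U1 cC0; exists (rho c) => //; split=> // n Nn.
have := congr1 rho (C0C cC0 Nn).
by rewrite !rhoM // rhoK => E; rewrite /commute -!etaM E.
Qed.

(* Since [pg g] only depends on the coset [g * L], [A] permutes finitely many
   homomorphisms [pg g : C0 -> Z]. *)
Let pg g c := p (c ^ g) ^ g^-1.

Let Zpg g c : A g -> C0 c -> Z (pg g c).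
Proof.
have [_ _ AV] := sA; move=> Ag cC0.
by apply: normalZ (AV _ Ag); apply: Zp; exact: normalC0.
Qed.

Let pgM g c d : A g -> C0 c -> C0 d -> pg g (c * d) = pg g c * pg g d.
Proof.
by move=> Ag cC0 dC0; rewrite /pg conjMg pM ?conjMg //; exact: normalC0.
Qed.

Let pgV g c : A g -> C0 c -> pg g c^-1 = (pg g c)^-1.
Proof.
by move=> Ag cC0; rewrite /pg conjVg pV ?conjVg //; exact: normalC0.
Qed.

Let pgZ g x : A g -> Z x -> pg g x = x.
Proof.
by move=> Ag Zx; rewrite /pg pZ; [rewrite -conjgM mulgV conjg1|exact: normalZ].
Qed.

Let pg_conj g h c : pg g (c ^ h) = pg (h * g) c ^ h.
Proof. by rewrite /pg -!conjgM invgM mulgVK. Qed.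

Let pg1 c : pg 1 c = p c.
Proof. by rewrite /pg invg1 !conjg1. Qed.

Let L := [set x | exists c n, [/\ C0 c, N n & x = c * eta n]].

Let subgroupL : subgroup L.
Proof.
have [N1 NM NV] := subgroupN; have [S1 SM SV] := subgroupC0.
split=> [|_ _ [c [n [cC0 Nn ->]]] [d [m [dC0 Nm ->]]]|_ [c [n [cC0 Nn ->]]]].
- by exists 1, 1; rewrite eta1 mulg1.
- exists (c * d), (n * m); split; [exact: SM|exact: NM|].
  by rewrite etaM -!mulgA (mulgA (eta n)) -(C0C dC0 Nn) !mulgA.
- exists c^-1, n^-1; split; [exact: SV|exact: NV|].
  by rewrite etaV -invgM -(C0C cC0 Nn).
Qed.

Let LA : L `<=` A.
Proof.
by have [_ AM _] := sA; move=> _ [c [n [/C0A Ac _ ->]]]; exact: AM.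
Qed.

Let normalL x g : L x -> A g -> L (x ^ g).
Proof.
move=> [c [n [cC0 Nn ->]]] Ag; have [m Nm mE] := normalN Ag Nn.
by exists (c ^ g), m; split=> //; [exact: normalC0|rewrite conjMg mE].
Qed.

(** Conjugation by an element of [C0] does not change [p], whose values lie in the abelian group
    [Z]; and both [C0] and the image of [N] centralise [Z]. *)
Let pgL g x c : A g -> L x -> C0 c -> pg (g * x) c = pg g c.
Proof.
move=> Ag [d [n [dC0 Nn ->]]] cC0; have eC0 := normalC0 cC0 Ag.
have [_ _ SV] := subgroupC0.
rewrite /pg !conjgM !invgM; move: (c ^ g) eC0 => e eC0; rewrite conjgM; congr (_ ^ _).
have edC0 : C0 (e ^ d) by apply: normalC0 => //; exact: C0A.
have -> : (e ^ d) ^ eta n = e ^ d by apply/conjg_fixP/commgP/(C0C edC0).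
have -> : p (e ^ d) = p e.
  rewrite conjgE !pM ?pV //; [|exact: SV|by case: subgroupC0 => _ SM _; exact: SM].
  by rewrite (commuteZ (Zp eC0) (Zp dC0)) mulKg.
rewrite conjgM.
have -> : p e ^ (eta n)^-1 = p e.
  apply/conjg_fixP/commgP/commuteV; exact: (C0C (ZC0 (Zp eC0))).
apply/conjg_fixP/commgP/commuteV/commute_sym; apply: commuteCZ; last exact: Zp.
exact: C0C.
Qed.

(** Up to finitely many [t], an element of [A] is a product of elements of [C] and of [H]; moreover
    [C0] has finite index in the part of [C] inside [A], and [N] has finite index in [H]. *)
Let finite_indexL : finite_index A L.
Proof.
have [_ AM AV] := sA; have [T TA TP] := outerN.
have [_ CM CV] := subgroupC.
have fC : finite_index (A `&` C) C0.
  have [K [k kP]] := finite_indexI finite_indexW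
    (finite_index_core sA subgroupU1 finite_indexU1).
  exists K, k => x y [Ax Cx] [Ay Cy] /(kP _ _ Ax Ay)[Wxy Uxy].
  split=> //; split=> //; split; first by apply: (AM) => //; exact: AV.
  by apply: (CM) => //; exact: CV.
have [R RA RP] := finite_index_reps fC.
have [S _ SP] := finite_index_reps finite_indexN.
apply: (@finite_index_cover _ _ _
  [seq r * eta k^-1 | r <- [seq t * r | t <- T, r <- R], k <- S]).
  exact: subgroupL.
move=> g Ag; have [t tT [h hC]] := TP g Ag.
set c := _ * eta h in hC.
have Ac : A c by apply: (AM) => //; apply: (AM) => //; apply: AV; exact: TA.
have [r rR rc] := RP c (conj Ac hC).
have [k kS Nk] := SP h I.
exists (t * r * eta k^-1).
  apply/allpairsP; exists (t * r, k); split=> //=.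
  by apply/allpairsP; exists (t, r).
have -> : (t * r * eta k^-1)^-1 * g =
    (r^-1 * c * eta (k^-1 * h)^-1) ^ eta k^-1.
  by rewrite /c conjgE !(etaM, etaV) !invgM !invgK ?gnorm.
apply: normalL => //; exists (r^-1 * c), (k^-1 * h)^-1; split=> //.
by case: subgroupN => _ _; apply.
Qed.

Let alpha g c := pg g c * (p c)^-1.

Let alphaM g c d : A g -> C0 c -> C0 d -> alpha g (c * d) = alpha g c * alpha g d.
Proof.
move=> Ag cC0 dC0; rewrite /alpha pgM // pM // invgM.
have cpd : commute (pg g d) (p c)^-1.
  by apply: commuteV; apply: commuteZ; [exact: Zpg|exact: Zp].
have cpp : commute (p d)^-1 (p c)^-1.
  by apply/commuteV/commute_sym/commuteV/commute_sym/commuteZ; exact: Zp.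
move: (pg g c) (pg g d) (p c)^-1 (p d)^-1 cpp cpd => a b u v cpp cpd.
by rewrite cpp !mulgA; congr (_ * _); rewrite -!mulgA; congr (_ * _).
Qed.

Let alphaV g c : A g -> C0 c -> alpha g c^-1 = (alpha g c)^-1.
Proof.
move=> Ag cC0; have [_ _ SV] := subgroupC0; apply/esym/mulg1_eq.
rewrite -alphaM //; last exact: SV.
have [S1 _ _] := subgroupZ.
by rewrite mulgV /alpha pgZ // pZ // mulgV.
Qed.

Let alphaZ g x : A g -> Z x -> alpha g x = 1.
Proof. by move=> Ag Zx; rewrite /alpha pgZ // pZ // mulgV. Qed.

Let Zalpha g c : A g -> C0 c -> Z (alpha g c).
Proof.
have [_ ZM ZV] := subgroupZ; move=> Ag cC0.
by apply: (ZM); [exact: Zpg|apply: ZV; exact: Zp].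
Qed.

(** Modulo the image of [N], [A] is finitely generated, and so is its finite-index subgroup [L].
    Inside the proof, [M] collects the elements of [L] satisfying the claim; its cosets by [ss]
    cover [A], which brings every element of [C0] into [M]. *)
Lemma alpha_span (ss : seq G) : (forall s, s \in ss -> A s) ->
  (forall x, A x -> exists2 s, s \in ss & L (s^-1 * x)) ->
  exists2 es : seq G, (forall e, e \in es -> exists s c, [/\ A s, C0 c & e = alpha s c]) &
    forall s c, s \in ss -> C0 c -> span es (alpha s c).
Proof.
move=> ssA ssP; have [_ AM AV] := sA; have [S1 SM SV] := subgroupC0.
have [N1 NM NV] := subgroupN; have [_ LM LV] := subgroupL.
have [Y YA YP] := X_cover.
have [S _ SP] := finite_index_reps finite_indexN.
(* Schreier generators: [alpha s] kills [eta @` N], so the elements of [C0]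
   that carry some [y * s] into its coset representative suffice. *)
pose Y' := [seq y * eta k | y <- Y, k <- S].
have Y'P x : X x -> exists y n, [/\ y \in Y', A y, N n & x = y * eta n].
  move=> /YP[y yY [h _ hE]]; have [k kS Nk] := SP h I.
  exists (y * eta k), (k^-1 * h); split=> //.
  - by apply/allpairsP; exists (y, k).
  - by apply: (AM) => //; exact: YA.
  - by rewrite etaM etaV hE ?gnorm.
have /choice[sel selP] : forall x, exists s, A x -> s \in ss /\ L (s^-1 * x).
  move=> x; have [Ax|] := pselect (A x); last by exists 1.
  by have [s sss Ls] := ssP x Ax; exists s.
have /choice[cf cfP] : forall l, exists c, L l ->
    C0 c /\ exists2 n, N n & l = c * eta n.
  move=> l; have [[c [n [cC0 Nn lE]]]|] := pselect (L l); last by exists 1.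
  by exists c => _; split=> //; exists n.
pose cs := [seq c <- [seq cf t^-1 | t <- ss] ++
  [seq cf ((sel (y * s))^-1 * (y * s)) | y <- Y', s <- ss] | `[< C0 c >]].
have csC0 c : c \in cs -> C0 c by rewrite mem_filter => /andP[/asboolP].
pose es := [seq alpha s c | s <- ss, c <- cs].
have esP e : e \in es -> exists s c, [/\ A s, C0 c & e = alpha s c].
  by move=> /allpairsP[[s c] /= [/ssA As /csC0 cC0 ->]]; exists s, c.
exists es => //.
have [E1 EM EV] : subgroup (span es).
  apply: subgroup_span => a b /esP[s [c [As cC0 ->]]] /esP[t [d [At dC0 ->]]].
  by apply: commuteZ; exact: Zalpha.
pose M := [set x | exists d n, [/\ C0 d, N n, x = d * eta n &
  forall s, s \in ss -> span es (alpha s d)]].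
have ML : M `<=` L by move=> _ [d [n [dC0 Nn -> _]]]; exists d, n.
have sM : subgroup M.
  split=> [|_ _ [c [n [cC0 Nn -> cE]]] [d [m [dC0 Nm -> dE]]]|_ [c [n [cC0 Nn -> cE]]]].
  - exists 1, 1; rewrite eta1 mulg1; split=> // s /ssA As.
    by rewrite alphaZ //; case: subgroupZ.
  - exists (c * d), (n * m); split; [exact: SM|exact: NM| |].
      by rewrite etaM -!mulgA (mulgA (eta n)) -(C0C dC0 Nn) !mulgA.
    by move=> s sss; rewrite alphaM //; [apply: EM; [exact: cE|exact: dE]|exact: ssA].
  - exists c^-1, n^-1; split; [exact: SV|exact: NV| |].
      by rewrite etaV -invgM -(C0C cC0 Nn).
    by move=> s sss; rewrite alphaV //; [apply: EV; exact: cE|exact: ssA].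
have csM c n : c \in cs -> N n -> M (c * eta n).
  move=> ccs Nn; exists c, n; split=> //; first exact: csC0.
  by move=> s sss; apply: mem_span; apply/allpairsP; exists (s, c).
have [M1 MM MV] := sM.
(* The representative of the coset [L] may differ from 1; this is why the list [cs] also contains
   the components of inverses of representatives. *)
have ssM t : t \in ss -> L t -> M t.
  move=> tss /LV Lt; have [cC0 [n Nn tE]] := cfP _ Lt.
  rewrite -[t]invgK; apply: MV; rewrite tE; apply: csM => //.
  rewrite mem_filter mem_cat map_f // andbT; exact/asboolP.
have MA g : A g -> exists2 t, t \in ss & M (t^-1 * g).
  apply: generated_cover => //.
    have [|s0ss Ls0] := selP 1; first by case: sA.
    exists (sel 1) => //; apply: ssM => //; rewrite -[sel 1]invgK; apply: LV.
    by move: Ls0; rewrite mulg1.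
  move=> x s /Y'P[y [n [yY' Ay Nn ->]]] sss.
  have Ays : A (y * s) by apply: (AM) => //; exact: ssA.
  have [tss Lt] := selP _ Ays; exists (sel (y * s)) => //.
  have [m Nm mE] := normalN (ssA s sss) Nn.
  have -> : (sel (y * s))^-1 * (y * eta n * s) =
      (sel (y * s))^-1 * (y * s) * eta m.
    by rewrite -mE conjgE ?gnorm.
  have [cC0 [n' Nn' {1}->]] := cfP _ Lt.
  rewrite -mulgA -etaM; apply: csM; last exact: NM.
  rewrite mem_filter mem_cat; apply/andP; split; first exact/asboolP.
  by apply/orP; right; apply/allpairsP; exists (y, s).
move=> s c sss cC0; have [t tss Mtc] := MA c (C0A cC0).
have Lc : L c by exists c, 1; rewrite eta1 mulg1.
have Mc : M c.
  rewrite -[c](mulVKg t); apply: (MM) => //; apply: ssM => //.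
  by have := LM _ _ Lc (LV _ (ML _ Mtc)); rewrite invgM invgK mulVKg.
have [d [n [dC0 Nn cE dE]]] := Mc.
(* The decomposition of [c] provided by [M] may differ from [c * 1], but its second factor is
   central in the image of [N], where [alpha s] vanishes. *)
have Zn : Z (eta n).
  exists n => //; split=> //.
  have -> : eta n = d^-1 * c by rewrite cE mulKg.
  by apply: C0C; apply: SM => //; exact: SV.
have As := ssA s sss; have nC0 := ZC0 Zn.
by rewrite cE alphaM // (alphaZ As Zn) mulg1; exact: dE.
Qed.

Lemma invariant_complement : exists F : set G,
  [/\ subgroup F, F `<=` A `&` W, (forall x g, F x -> A g -> F (x ^ g)),
      forall h, F (eta h) -> h = 1 &
      finite_index A [set x | exists2 f, F f & range eta (f^-1 * x)]].
Proof.
have [_ AM AV] := sA; have [A1 _ _] := sA.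
have [ss [uss ssP ssK]] := transversal sA subgroupL LA finite_indexL.
have ssA s : s \in ss -> A s by move=> /ssK[].
have [es esP esS] : exists2 es : seq G,
    (forall e, e \in es -> exists s c, [/\ A s, C0 c & e = alpha s c]) &
    forall s c, s \in ss -> C0 c -> span es (alpha s c).
  apply: alpha_span => // x /[dup] Ax /ssP sx; exists (coset_rep L x) => //.
  have [_ _ LV] := subgroupL.
  by have := LV _ (coset_repP x subgroupL); rewrite invgM invgK.
have pg_rep g c : A g -> C0 c -> pg g c = pg (coset_rep L g) c.
  move=> Ag cC0; rewrite -[in RHS](mulVKg g (coset_rep L g)) pgL //.
  exact: coset_repP.
set E := span es in esS.
have Ealpha g c : A g -> C0 c -> E (alpha g c).
  by move=> Ag cC0; rewrite /alpha pg_rep //; apply: esS => //; exact: ssP.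
have EZ : E `<=` Z.
  by apply: span_min => // e /esP[s [c [As cC0 ->]]]; exact: Zalpha.
have ces : {in es &, forall x y, commute x y}.
  by move=> x y /mem_span/EZ Zx /mem_span/EZ; exact: commuteZ.
have sE : subgroup E by exact: subgroup_span.
have normalE x h : E x -> A h -> E (x ^ h).
  move=> + Ah; have [E1 EM EV] := sE.
  apply: (@span_min _ [set x | E (x ^ h)]) => [|e /esP[s [c [As cC0 ->]]]].
    split=> [|a b /= Ea Eb|a /= Ea].
    - by rewrite /= conj1g.
    - by rewrite conjMg; exact: EM.
    - by rewrite conjVg; exact: EV.
  have cC0' := normalC0 cC0 Ah.
  have e1 : pg (h^-1 * s) (c ^ h) = pg s c ^ h by rewrite pg_conj mulVKg.
  have e2 : pg h^-1 (c ^ h) = p c ^ h by rewrite pg_conj mulgV pg1.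
  (* Conjugation by [h] turns the quotient of [pg s] by [p] into that of [pg (h^-1 * s)] by
     [pg h^-1], in which [p] cancels. *)
  have alphaJ : alpha s c ^ h = alpha (h^-1 * s) (c ^ h) * (alpha h^-1 (c ^ h))^-1.
    rewrite /alpha e1 e2 conjMg conjVg.
    move: (pg s c ^ h) (p c ^ h) (p (c ^ h)) => a b d.
    by rewrite invgM invgK mulgA mulgVK.
  change (E (alpha s c ^ h)); rewrite alphaJ.
  have AhV := AV _ Ah.
  by apply: (EM); [|apply: EV]; apply: Ealpha => //; exact: AM.
have [k k0 kP] := span_torsion ces.
pose m := size ss.
have m0 : (0 < m)%N.
  by have := ssP 1 A1; rewrite /m; case: (ss).
pose E' := powers k E.
have cE : {in E &, forall x y, commute x y}.
  by move=> x y /set_mem/EZ Zx /set_mem/EZ; exact: commuteZ.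
have sE' : subgroup E' by exact: subgroup_powers.
have E'E : E' `<=` E.
  have [E1 EM _] := sE.
  move=> _ [x Ex ->]; elim: (k) => [//|i IH]; first by rewrite expgS; exact: EM.
have E'm x : E' x -> x ^+ m = 1 -> x = 1.
  move=> [y Ey ->]; rewrite -expgnA => /(kP y _ Ey); apply.
  by rewrite muln_gt0 k0.
have normalE' x h : E' x -> A h -> E' (x ^ h).
  by move=> [y Ey ->] Ah; exists (y ^ h); [exact: normalE|rewrite conjXg].
pose tau c := \prod_(s <- ss) pg s c.
have tauE c : tau c = \prod_(s <- ss | s \in ss) pg s c by rewrite /tau big_seq.
have tauM c d : C0 c -> C0 d -> tau (c * d) = tau c * tau d.
  move=> cC0 dC0; rewrite !tauE -prodgM_commute => [|s t /ssA As /ssA At].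
    by apply: eq_bigr => s /ssA As; rewrite pgM.
  by apply: commuteZ; exact: Zpg.
have tauZ x : Z x -> tau x = x ^+ m.
  move=> Zx; rewrite tauE (eq_bigr (fun=> x)) => [|s /ssA As]; last exact: pgZ.
  by rewrite -big_seq big_const_seq count_predT iter_mulg_1.
(* Left multiplication by [h] permutes the cosets of [L], hence the commuting factors of [tau]. *)
have tauJ c h : C0 c -> A h -> tau (c ^ h) = tau c ^ h.
  move=> cC0 Ah; rewrite /tau; transitivity (\prod_(s <- ss) (pg (h * s) c ^ h)).
    by apply: eq_bigr => s _; rewrite pg_conj.
  rewrite -conjg_prod; congr (_ ^ _); rewrite big_seq.
  transitivity (\prod_(s <- [seq coset_rep L (h * s) | s <- ss]) pg s c).
    rewrite big_map [RHS]big_seq; apply: eq_bigr => s /ssA As.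
    by rewrite pg_rep //; exact: AM.
  apply: perm_prodg_commute => [_ _ /mapP[s /ssA As ->] /mapP[t /ssA At ->]|].
    by apply: commuteZ; apply: Zpg => //; apply: ssA; apply: ssP; exact: AM.
  have ums : uniq [seq coset_rep L (h * s) | s <- ss].
    rewrite map_inj_in_uniq // => s t sss tss st; have [_ LM LV] := subgroupL.
    have := LM _ _ (coset_repP (h * s) subgroupL)
      (LV _ (coset_repP (h * t) subgroupL)).
    rewrite st ?gnorm => Lst.
    have [_ <-] := ssK s sss; have [_ <-] := ssK t tss.
    exact: eq_coset_rep.
  apply: uniq_perm => //; apply: (uniq_min_size ums _ _).2.
    by move=> _ /mapP[s /ssA As ->]; apply: ssP; exact: AM.
  by rewrite size_map.
have [C01 CM CV] := subgroupC0; have [E'1 E'M E'V] := sE'.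
(* The condition on [pg] excludes the torsion that [tau] cannot see: on [Z] every [pg g] is the
   identity and [tau] is the power [m], while [E'] has no [m]-torsion. *)
pose F := [set c | [/\ C0 c, forall g, A g -> E' (pg g c) & tau c = 1]].
have sF : subgroup F.
  have Z1 : Z 1 by case: subgroupZ.
  split=> [|c d [cC0 cE' tc] [dC0 dE' td]|c [cC0 cE' tc]].
  - split=> //; last by rewrite tauZ // expg1n.
    by move=> g Ag; rewrite pgZ.
  - split; first exact: CM.
      by move=> g Ag; rewrite pgM //; apply: E'M; [exact: cE'|exact: dE'].
    by rewrite tauM // tc td mulg1.
  - split; first exact: CV.
      by move=> g Ag; rewrite pgV //; apply: E'V; exact: cE'.
    have : tau (c^-1 * c) = tau 1 by rewrite mulVg.
    rewrite tauM //; last exact: CV.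
    by rewrite tc mulg1 (tauZ _ Z1) expg1n.
have normalF x g : F x -> A g -> F (x ^ g).
  move=> [cC0 cE' tc] Ag; split; first exact: normalC0.
    move=> h Ah; rewrite pg_conj; apply: normalE' => //; apply: cE'; exact: AM.
  by rewrite tauJ // tc conj1g.
exists F; split=> //.
- by move=> c [[[[Ac _] Wc] _] _ _].
- move=> h [hC0 hE' th]; have Zh : Z (eta h).
    exists h; last by split=> //; exact: C0C.
    by have [_] := C0U1 hC0; rewrite rhoK.
  apply: (can_inj rhoK); rewrite eta1; apply: E'm.
    by have := hE' 1 A1; rewrite pgZ.
  by rewrite -tauZ.
pose FH := [set x | exists2 f, F f & range eta (f^-1 * x)].
have FHP f h : F f -> FH (f * eta h) by move=> Ff; exists f; rewrite // mulKg; exists h.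
have FHE x : FH x -> exists f h, F f /\ x = f * eta h.
  by move=> [f Ff [h _ hE]]; exists f, h; rewrite hE mulVKg.
have [F1 FM FV] := sF.
have sFH : subgroup FH.
  split=> [|x y|x].
  - by rewrite -[1]mulg1 -[X in FH (_ * X)]eta1; exact: FHP.
  - move=> /FHE[f [h [Ff ->]]] /FHE[f' [h' [Ff' ->]]].
    have -> : f * eta h * (f' * eta h') = f * f' ^ eta h^-1 * eta (h * h').
      by rewrite etaM conjgE etaV ?gnorm.
    by apply: FHP; apply: FM => //; exact: normalF.
  - move=> /FHE[f [h [Ff ->]]].
    have -> : (f * eta h)^-1 = f^-1 ^ eta h * eta h^-1.
      by rewrite conjgE etaV ?gnorm.
    by apply: FHP; apply: normalF => //; exact: FV.
have fC0 : finite_index C0 FH.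
  pose E'' := powers m E'.
  have [K [kap kapP]] : finite_index E E''.
    (* [E''] contains all powers of exponent [k * m] of elements of [E], so it has finite index in
       [E] and not merely in [E']. *)
    have km0 : (0 < k * m)%N by rewrite muln_gt0 k0.
    apply: finite_index_sub (finite_index_span_powers ces km0) => //.
    by move=> _ [x Ex ->]; exists (x ^+ k); [exists x|rewrite expgnA].
  (* If the [p_g] of [e = (hat c)^-1 * hat d] lie in [E'^m], then [tau e = y ^+ m]
     with [y] in [E'], and [e * y^-1] is in [F]. *)
  pose hat c := c * (p c)^-1.
  have hatC0 c : C0 c -> C0 (hat c).
    by move=> cC0; apply: CM => //; apply: CV; exact/ZC0/Zp.
  (* Dividing by [p c] brings the values of all [pg g] into the finitely generated group [E], where
     powers have finite index. *)
  have pg_hat g c : A g -> C0 c -> pg g (hat c) = alpha g c.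
    move=> Ag cC0; have Zpc := Zp cC0.
    have ZpV : Z (p c)^-1 by case: subgroupZ => _ _; apply.
    by rewrite pgM // ?(pgZ Ag ZpV) //; exact: ZC0.
  exists {ffun 'I_(size ss) -> K},
    (fun c => [ffun i : 'I_(size ss) => kap (alpha (nth 1 ss i) c)]).
  move=> c d cC0 dC0 cd.
  pose e := (hat c)^-1 * hat d.
  have eC0 : C0 e by apply: CM; [apply: CV|]; exact: hatC0.
  have eE'' g : A g -> E'' (pg g e).
    move=> Ag; rewrite pg_rep //; have := ssP g Ag; set s := coset_rep L g => sss.
    have As := ssA s sss.
    rewrite pgM ?pgV ?pg_hat //; [|exact: hatC0|by apply: CV; exact: hatC0|exact: hatC0].
    apply: kapP; [exact: Ealpha|exact: Ealpha|].
    have is_ : (index s ss < size ss)%N by rewrite index_mem.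
    have := congr1 (fun f : {ffun 'I_(size ss) -> K} => f (Ordinal is_)) cd.
    by rewrite !ffunE /= nth_index.
  have E'X x i : E' x -> E' (x ^+ i).
    by move=> Ex; elim: i => // i IH; rewrite expgS; exact: E'M.
  have [E''1 E''M _] : subgroup E''.
    apply: subgroup_powers => // x y /set_mem/E'E/EZ Zx /set_mem/E'E/EZ.
    exact: commuteZ.
  have [y E'y ty] : E'' (tau e).
    by rewrite tauE; apply: big_ind => // s /ssA; exact: eE''.
  have Zy : Z y by exact/EZ/E'E.
  have ZyV : Z y^-1 by case: subgroupZ => _ _; apply.
  have [_ ZM ZV] := subgroupZ.
  (* The corrections by [p c], [p d] and [y] together lie in [Z], hence in the image of [H], which
     [FH] absorbs. *)
  have [n _ [_ nE]] : Z (y * ((p c)^-1 * p d)).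
    by apply: (ZM) => //; apply: (ZM); [apply: ZV|]; exact: Zp.
  suff -> : c^-1 * d = e * y^-1 * eta n.
    apply: FHP; split; first by apply: CM => //; exact: ZC0.
    - move=> g Ag; rewrite pgM //; last exact: ZC0.
      rewrite (pgZ Ag ZyV); apply: E'M; last exact: E'V.
      by have [x Ex ->] := eE'' g Ag; exact: E'X.
    - rewrite tauM //; last exact: ZC0.
      by rewrite ty (tauZ _ ZyV) expVgn mulgV.
  rewrite -nE (mulgA (e * y^-1)) mulgVK mulgA.
  have epc : commute e (p c)^-1.
    by apply: commuteV; apply: commuteCZ; [exact: C0C|exact: Zp].
  rewrite epc /e /hat; move: (p c) (p d) => a b.
  by rewrite ?gnorm.
have [R RC0 RP] := finite_index_reps fC0.
apply: (@finite_index_cover _ _ _ [seq s * r | s <- ss, r <- R]).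
  exact: sFH.
move=> x /[dup] Ax /ssP; have := coset_repP x subgroupL.
set s := coset_rep L x => xs sss; have [_ _ LV] := subgroupL.
have [c [n [cC0 Nn sxE]]] : L (s^-1 * x) by have := LV _ xs; rewrite invgM invgK.
have [r rR /FHE[f [h [Ff rE]]]] := RP c cC0.
exists (s * r); first by apply/allpairsP; exists (s, r).
have -> : (s * r)^-1 * x = f * eta (h * n).
  by rewrite etaM mulgA -rE -mulgA -sxE ?gnorm.
exact: FHP.
Qed.

End InvariantComplement.

(** * Completions and virtual retracts *)

Lemma open_mono_range (H G : profiniteGroupType) (iota : H -> G) :
  open_mono iota -> open_subgroup (range iota).
Proof.
move=> oi; have [[mi _] _ _] := oi; split; first exact: subgroup_range.
by have [<- _] := mi; apply: (open_mono_nbhs oi); exact: filterT.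
Qed.

Lemma open_mono_finite_index (H G : profiniteGroupType) (iota : H -> G) :
  open_mono iota -> finite_index setT (range iota).
Proof.
by move=> /open_mono_range; apply: open_subgroup_finite_index; exact: profinite_compact.
Qed.

Lemma open_subgroup_preimage (H G : profiniteGroupType) (f : H -> G) (A : set G) :
  continuous_hom f -> open_subgroup A -> open_subgroup (f @^-1` A).
Proof.
move=> [mf cf] [sA nA]; split; first exact: subgroup_preimage.
by apply: cf; have [-> _] := mf.
Qed.

(** * The subgroup generated by two compatible images *)

Section Amalgam.
Context (H G1 G2 : profiniteGroupType) (iota1 : H -> G1) (iota2 : H -> G2).
Hypothesis iotaC : commensuration iota1 iota2.
Context (G : groupType) (h1 : G1 -> G) (h2 : G2 -> G).
Hypotheses (mh1 : monoid_morphism h1) (mh2 : monoid_morphism h2).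
Hypothesis hE : h1 \o iota1 = h2 \o iota2.
Let X := range h1 `|` range h2.

Lemma amalgam_inv x : X x -> X x^-1.
Proof.
by case=> -[y _ <-]; [left|right]; exists y^-1; rewrite ?morphismV.
Qed.

Lemma amalgam_cover : exists2 Y : seq G,
  (forall y, y \in Y -> generated X y) &
  forall x, X x -> exists2 y, y \in Y & range (h1 \o iota1) (y^-1 * x).
Proof.
have [oi1 oi2] := iotaC.
have [s1 _ s1P] := finite_index_reps (open_mono_finite_index oi1).
have [s2 _ s2P] := finite_index_reps (open_mono_finite_index oi2).
exists (map h1 s1 ++ map h2 s2).
  move=> y; rewrite mem_cat => /orP[] /mapP[x _ ->]; apply: mem_generated.
  - by left; exists x.
  - by right; exists x.
have [_ h1M] := mh1; have [_ h2M] := mh2.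
move=> _ [[x _ <-]|[x _ <-]].
- have [y ys [n _ nE]] := s1P x I; exists (h1 y).
    by rewrite mem_cat map_f.
  by exists n => //=; rewrite nE h1M morphismV.
- have [y ys [n _ nE]] := s2P x I; exists (h2 y).
    by rewrite mem_cat orbC map_f.
  by exists n => //; rewrite hE /= nE h2M morphismV.
Qed.

Lemma amalgam_base : range (h1 \o iota1) `<=` generated X.
Proof. by move=> _ [n _ <-]; apply: mem_generated; left; exists (iota1 n). Qed.

End Amalgam.

(** * From a completion to a virtual retract *)

Lemma completion_virtual_retract (H G1 G2 : profiniteGroupType)
    (iota1 : H -> G1) (iota2 : H -> G2) (G : profiniteGroupType)
    (g1 : G1 -> G) (g2 : G2 -> G) :
  commensuration iota1 iota2 -> free_profinite_amalgam iota1 iota2 g1 g2 ->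
  admits_completion iota1 iota2 ->
  injective (g1 \o iota1) /\ virtual_retract (range (g1 \o iota1)).
Proof.
move=> [oi1 oi2] [[mg1 cg1] [mg2 cg2] gE univ] [K [j1 [j2 [oj1 oj2 jE]]]].
have [[mj1 cj1] j1I _] := oj1; have [cj2 _ _] := oj2.
have [[mi1 ci1] i1I _] := oi1.
have [f [[[mf cf] fg1 fg2] _]] := univ K j1 j2 (conj mj1 cj1) cj2 jE.
pose eta := g1 \o iota1; pose phi := j1 \o iota1.
have feta h : f (eta h) = phi h by rewrite /phi -fg1.
have phiI : injective phi by exact: inj_comp.
have phi_nbhs h (A : set H) : nbhs h A -> nbhs (phi h) (phi @` A).
  move=> /(open_mono_nbhs oi1)/(open_mono_nbhs oj1).
  by apply: filterS => _ [_ [n An <-] <-]; exists n.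
have mphi : monoid_morphism phi.
  exact: monoid_morphism_comp.
have meta : monoid_morphism eta.
  exact: monoid_morphism_comp.
have ceta : continuous eta.
  by move=> x; apply: continuous_comp; [exact: ci1|exact: cg1].
have etaI : injective eta by move=> x y exy; apply: phiI; rewrite -!feta exy.
split=> //.
have gc (D : profiniteGroupType) (A : set D) : subgroup A -> group_closed [in A].
  move=> [A1 AM AV]; split; first by rewrite inE.
  by move=> x y; rewrite !inE => Ax Ay; apply: (AM) => //; exact: AV.
split.
- exact/gc/subgroup_range.
- apply: compact_closed; first exact: profinite_hausdorff.
  apply: continuous_compact; first exact/continuous_subspaceT.
  exact: profinite_compact.
have olat : open_subgroup (range phi).
  split; first exact: subgroup_range.
  by have [<- _] := mphi; apply: phi_nbhs; exact: filterT.
pose U := f @^-1` range phi.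
(* [inv] is $\phi^{-1} \circ f$ on [U], with default value 1 elsewhere. Its continuity on [U] comes
   from [phi] being an open map. *)
have /choice[inv invP] : forall u, exists h, U u -> phi h = f u.
  move=> u; have [[h _ hE]|] := pselect (U u).
    by exists h.
  by exists 1.
have oU : open_subgroup U by exact: open_subgroup_preimage.
exists U, (eta \o inv); split; split.
- by apply: gc; case: oU.
- exact: open_subgroup_open.
- by move=> _ [h _ <-]; exists h; rewrite // feta.
- move=> x y /[!inE] Ux Uy /=; have [_ etaM] := meta; rewrite -etaM; congr eta.
  apply: phiI; have [_ phiM] := mphi; have [_ fM] := mf.
  rewrite phiM !invP ?fM //; by case: oU => -[_ UM _] _; exact: UM.
- apply/subspace_continuousP => x Ux A nA.
  have nA' : nbhs (f x) (phi @` (eta @^-1` A)).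
    by rewrite -invP //; apply: phi_nbhs; exact: ceta.
  have nf : nbhs x [set y | (phi @` (eta @^-1` A)) (f y)] by exact: cf nA'.
  change (nbhs x [set y | U y -> A (eta (inv y))]).
  apply: filterS nf => y [h Ah hE] Uy.
  by have -> : inv y = h; [apply: phiI; rewrite invP|].
- apply/seteqP; split=> [_ [u Uu <-]|_ [h _ <-]]; first by exists (inv u).
  exists (eta h); first by exists h; rewrite // feta.
  by rewrite /= ; congr eta; apply: phiI; rewrite invP ?feta //; exists h; rewrite // feta.
- move=> _ /[!inE] -[h _ <-] /=; congr eta; apply: phiI.
  by rewrite invP ?feta //; exists h; rewrite // feta.
Qed.

(** * From a virtual retract to a completion *)

Lemma virtual_retract_completion (H G1 G2 : profiniteGroupType)
    (iota1 : H -> G1) (iota2 : H -> G2) (G : profiniteGroupType)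
    (g1 : G1 -> G) (g2 : G2 -> G) :
  commensuration iota1 iota2 ->
  continuous_hom g1 -> continuous_hom g2 -> g1 \o iota1 = g2 \o iota2 ->
  injective (g1 \o iota1) -> virtual_retract (range (g1 \o iota1)) ->
  admits_completion iota1 iota2.
Proof.
move=> co [mg1 _] [mg2 _] gE etaI [_ _ [U [r [[gU oU etaU] [rM _ rU rK]]]]].
have [oi1 oi2] := co.
have [[mi1 ci1] i1I _] := oi1; have [[mi2 ci2] i2I _] := oi2.
pose eta := g1 \o iota1.
have meta : monoid_morphism eta by exact: monoid_morphism_comp.
have sU : subgroup U.
  split=> [|x y Ux Uy|x Ux].
  - by have [/set_mem] := gU.
  - by apply: set_mem; apply: (group_closedM gU); exact: mem_set.
  - by apply: set_mem; apply: (group_closedV gU); exact: mem_set.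
have fU : finite_index setT U.
  apply: open_subgroup_finite_index; first exact: profinite_compact.
  by split=> //; case: sU => U1 _ _; exact: open_nbhs_nbhs.
have /choice[rho rhoP] : forall u, exists h, U u -> eta h = r u.
  move=> u.
  have [Uu|] := pselect (U u); last by exists 1.
  have [h _ hE] : range eta (r u) by rewrite -rU; exists u.
  by exists h.
have rhoM u v : U u -> U v -> rho (u * v) = rho u * rho v.
  move=> Uu Uv; apply: etaI; rewrite -/eta; have [_ ->] := meta.
  rewrite !rhoP //; last by case: sU => _ UM _; exact: UM.
  by rewrite rM //; exact: mem_set.
have rhoK h : rho (eta h) = h.
  apply: etaI; rewrite -/eta rhoP; last by apply: etaU; exists h.
  by rewrite rK // inE; exists h.
(* Conjugates in [G1] or [G2] of elements of [V] stay in the image of [H]. Since [eta] is injective,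
   invariance of [N] observed in [G] therefore descends to normality in [G1] and [G2]. *)
pose V := (iota1 @^-1` core setT (range iota1)) `&`
          (iota2 @^-1` core setT (range iota2)).
have oV : open_subgroup V.
  by apply: open_subgroupI; apply: open_subgroup_preimage => //;
    apply: open_subgroup_core; [exact: profinite_compact|exact: open_mono_range|
    exact: profinite_compact|exact: open_mono_range].
have [N [oN NV Nn _]] := finite_outer_action meta (amalgam_inv mg1 mg2)
  (amalgam_cover co mg1 mg2 gE) (generated_commensurated co mg1 mg2 gE)
  (@amalgam_base _ _ _ iota1 _ g1 g2) sU etaU
  (finite_index_sub (@subsetT _ _) (fun _ h => h) fU) rhoM rhoK oV.
have [sN _] := oN.
have fN : finite_index setT N.
  by apply: open_subgroup_finite_index => //; exact: profinite_compact.
have norm1 x n : N n -> exists2 m, N m & iota1 n ^ x = iota1 m.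
  move=> /[dup] Nn' /NV[/(_ x I)[m _ mE] _].
  have [|p Np pE] := Nn (g1 x) n _ Nn'.
    by apply: mem_generated; left; exists x.
  exists p => //; rewrite -mE; congr iota1; apply: etaI.
  by rewrite /= mE morphismJ.
have norm2 x n : N n -> exists2 m, N m & iota2 n ^ x = iota2 m.
  move=> /[dup] Nn' /NV[_ /(_ x I)[m _ mE]].
  have [|p Np pE] := Nn (g2 x) n _ Nn'.
    by apply: mem_generated; right; exists x.
  exists p => //; rewrite -mE; congr iota2; apply: etaI.
  by rewrite -[RHS]pE /eta gE /= mE morphismJ.
have [T [f1 [f2 [[mf1 mf2] fE fN1 f1I f2I]]]] :=
  finite_amalgam mi1 i1I (open_mono_finite_index oi1) norm1
                 mi2 i2I (open_mono_finite_index oi2) norm2 sN fN.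
pose D : groupType := (G * {perm T})%type.
pose h1 x : D := (g1 x, f1 x); pose h2 x : D := (g2 x, f2 x).
have mh1 : monoid_morphism h1.
  by have [a b] := mg1; have [c d] := mf1; split=> [|x y]; rewrite /h1 ?a ?c ?b ?d.
have mh2 : monoid_morphism h2.
  by have [a b] := mg2; have [c d] := mf2; split=> [|x y]; rewrite /h2 ?a ?c ?b ?d.
have hE : h1 \o iota1 = h2 \o iota2.
  apply/funext => x; congr (_, _).
  - exact: (congr1 (fun f => f x) gE).
  - exact: (congr1 (fun f => f x) fE).
pose theta := h1 \o iota1.
have mtheta : monoid_morphism theta by exact: monoid_morphism_comp.
pose X := range h1 `|` range h2.
pose U' : set D := [set u | U u.1]; pose rho' (u : D) := rho u.1.
have sU' : subgroup U'.
  by case: sU => U1 UM UV; split=> [//|[x ?] [y ?]|[x ?]]; [exact: UM|exact: UV].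
have thetaU' : range theta `<=` U'.
  by move=> _ [n _ <-]; apply: etaU; exists n.
have fU' : finite_index (generated X) U'.
  have [K [k kP]] := fU; exists K, (fun u => k u.1) => x y _ _ /kP; exact.
have rhoM' u v : U' u -> U' v -> rho' (u * v) = rho' u * rho' v by exact: rhoM.
have rhoK' h : rho' (theta h) = h by exact: rhoK.
have Xinv := amalgam_inv mh1 mh2.
have Xcov := amalgam_cover co mh1 mh2 hE.
have Xbase := @amalgam_base _ _ _ iota1 _ h1 h2.
(* The finite outer action is now taken in [D], with [N] in place of [V]: elements of [N'] have
   trivial permutation part and so are sent into [W]. *)
have [N' [oN' N'N N'n outer]] := finite_outer_action mtheta Xinv Xcov
  (generated_commensurated co mh1 mh2 hE) Xbase sU' thetaU' fU' rhoM' rhoK' oN.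
have fN' : finite_index setT N'.
  by apply: open_subgroup_finite_index => //; exact: profinite_compact.
pose W : set D := [set u | u.2 = 1].
have sW : subgroup W.
  split=> [//|x y|x]; rewrite /W /=; first by move=> -> ->; rewrite mulg1.
  by move=> ->; rewrite invg1.
have nW x g : W x -> generated X g -> W (x ^ g).
  move=> Wx _; have -> : x ^ g = (x.1 ^ g.1, x.2 ^ g.2) by [].
  by rewrite /W /= Wx conj1g.
have fW : finite_index (generated X) W.
  by exists {perm T}, snd => x y _ _ /= xy; rewrite /W /= xy mulVg.
have thetaW : theta @` N' `<=` W.
  by move=> _ [n /N'N Nn' <-]; rewrite /W /= fN1.
have [sN' _] := oN'.
have [F [sF FAW nF Ftheta fF]] := invariant_complement mtheta Xinv Xcov Xbase
  sU' thetaU' fU' rhoM' rhoK' sN' fN' N'n outer sW nW fW thetaW.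
have sA : subgroup (generated X) by exact: subgroup_generated.
have FA : F `<=` generated X by move=> x /FAW[].
have [Q [q [qM qP qS]]] := subquotient sA sF FA nF.
have [A1 AM AV] := sA.
have q1 : q 1 = 1.
  by apply: (mulgI (q 1)); rewrite -qM // !mulg1.
have A_h1 x : generated X (h1 x) by apply: mem_generated; left; exists x.
have A_h2 x : generated X (h2 x) by apply: mem_generated; right; exists x.
(* If [h x] lies in [F], it lies in [W], so [f x = 1] and [x] comes from [H]; as [F] meets the image
   of [H] trivially, [x = 1]. *)
have faithful (E : profiniteGroupType) (i : H -> E) (h : E -> D)
    (f : E -> {perm T}) : monoid_morphism i ->
    monoid_morphism h -> h \o i = theta ->
    (forall x, generated X (h x)) -> (forall x, (h x).2 = f x) ->
    (forall x, f x = 1 -> (i @` N) x) -> injective (q \o h).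
  move=> [i1 _] mh hi Ah hf fI x y /= /(qP _ _ (Ah x) (Ah y)).
  have -> : (h x)^-1 * h y = h (x^-1 * y).
    by have [_ ->] := mh; rewrite morphismV.
  move=> Fxy; have [_] := FAW _ Fxy; rewrite /W /= hf => /fI[n _ nE].
  move: Fxy; rewrite -nE -[h (i n)]/((h \o i) n) hi => /Ftheta n1.
  by apply/esym/(mulgI x^-1); rewrite mulVg -nE n1 i1.
have morph (E : profiniteGroupType) (h : E -> D) : monoid_morphism h ->
    (forall x, generated X (h x)) -> monoid_morphism (q \o h).
  by move=> [h11 hM] Ah; split=> [|x y] /=; rewrite ?h11 // hM qM.
have A_theta n : generated X (theta n) by exact: A_h1.
have jE : (q \o h1) \o iota1 = (q \o h2) \o iota2.
  by apply/funext => n; rewrite -[LHS]/(q (theta n)) /theta hE.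
apply: (@extension_completion H G1 G2 Q iota1 iota2 (q \o h1) (q \o h2)) => //.
- exact: morph.
- exact: (faithful _ iota1 h1 f1).
- exact: morph.
- exact: (faithful _ iota2 h2 f2).
- have /choice[l lP] : forall z, exists x, generated X x /\ z = q x.
    by move=> z; have [x Ax zE] := qS z; exists x.
  have [K [k kP]] := fF; exists K, (k \o l) => x y _ _ /= kxy.
  have [Ax xE] := lP x; have [Ay yE] := lP y.
  have [f Ff [n _ nE]] := kP _ _ Ax Ay kxy; exists n => //.
  have qV u : generated X u -> q u^-1 = (q u)^-1.
    by move=> Au; apply/esym/mulg1_eq; rewrite -qM ?mulgV //; exact: AV.
  have qf : q f = 1.
    rewrite -q1; apply/qP => //; first exact: FA.
    by case: sF => _ _ FV; rewrite mulg1; exact: FV.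
  have Axy : generated X ((l x)^-1 * l y) by apply: (AM) => //; exact: AV.
  rewrite -[LHS]/(q (theta n)) nE qM //; last exact/AV/FA.
  rewrite qV ?qf; last exact: FA.
  by rewrite invg1 mul1g qM ?qV -?xE -?yE //; exact: AV.
- move=> z; have [x Ax ->] := qS z; elim: Ax => [|a b Xa Ab IH].
    by rewrite q1; exact: generated1.
  rewrite qM //; last exact: mem_generated.
  apply: generatedM => //.
  by case: Xa => -[y _ <-]; [left|right]; exists y.
Qed.

Theorem theorem2 (H G1 G2 : profiniteGroupType)
    (iota1 : H -> G1) (iota2 : H -> G2)
    (hiota : commensuration iota1 iota2)
    (G : profiniteGroupType) (g1 : G1 -> G) (g2 : G2 -> G)
    (hG : free_profinite_amalgam iota1 iota2 g1 g2) :
  admits_completion iota1 iota2 <->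
  (injective (g1 \o iota1) /\ virtual_retract (range (g1 \o iota1))).
Proof.
split=> [|[etaI retr]]; first exact: (completion_virtual_retract hiota hG).
by case: hG => mg1 mg2 gE _; exact: (virtual_retract_completion hiota mg1 mg2 gE).
Qed.
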